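(* Let $M$ be a real constant and let $g$ be a complex-valued harmonic function in the unit disk $U$ with $g(0)=\lambda_g(0)-1=0$ and $|g(z)|\le M$ for all $z\in U$. Put $$K(M)=\min\Bigl\{\sqrt{2M^2-2},\ \frac{4M}{\pi}\Bigr\},\qquad r_3=\frac{1}{1+2K(M)+\sqrt{K(M)+4K(M)^2}},$$ and $$\sigma_3=\begin{cases} r_3^3-K(M)\cdot\dfrac{r_3^4}{1-r_3}, & M>1,\\ 1, & M=1.\end{cases}$$ Then $F(z)=|z|^2g(z)$ is univalent in the disk $U_{r_3}$, and $F(U_{r_3})$ contains the schlicht disk $U_{\sigma_3}$. The result is sharp for $M=1$, i.e. for $M=1$ the radii $r_3=\sigma_3=1$ are best possible (neither can be replaced by a larger constant valid for all such $g$).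
   Context: $U=\{z\in\mathbb{C}:|z|<1\}$ is the open unit disk and, for $r>0$, $U_r=\{z\in\mathbb{C}:|z|<r\}$. Univalent means injective. For a differentiable complex-valued function $f$, with $z=x+iy$, put $f_z=\frac12(f_x-if_y)$, $f_{\overline z}=\frac12(f_x+if_y)$, and $\lambda_f(z)=\bigl||f_z(z)|-|f_{\overline z}(z)|\bigr|$. (The hypotheses force $M\ge1$.) *)

(* Defs.v *)
From Stdlib Require Import Reals.
From Coquelicot Require Import Coquelicot.

Open Scope R_scope.

Definition disk (r : R) (z : C) : Prop := Cmod z < r.

(** Twice continuously differentiable with vanishing Laplacian on the open set
    [D]; requiring [ex_diff_n u 2] at every point of an open set says that all
    partial derivatives of order at most 2 exist and are continuous there. *)
Definition harmonic_real_on (D : C -> Prop) (u : R -> R -> R) : Prop :=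
  forall x y : R, D (x, y) ->
    ex_diff_n u 2 x y /\
    partial_derive 2 0 u x y + partial_derive 0 2 u x y = 0.

Definition harmonic_on (D : C -> Prop) (f : C -> C) : Prop :=
  harmonic_real_on D (fun x y => Re (f (x, y))) /\
  harmonic_real_on D (fun x y => Im (f (x, y))).

(** Partial derivatives of [f] with respect to [x] and [y], [z = x + i y]. *)
Definition Dx (f : C -> C) (z : C) : C :=
  (Derive (fun t => Re (f (t, Im z))) (Re z),
   Derive (fun t => Im (f (t, Im z))) (Re z)).

Definition Dy (f : C -> C) (z : C) : C :=
  (Derive (fun t => Re (f (Re z, t))) (Im z),
   Derive (fun t => Im (f (Re z, t))) (Im z)).

Definition Dz (f : C -> C) (z : C) : C :=
  (RtoC (1 / 2) * (Dx f z - Ci * Dy f z))%C.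

Definition Dzbar (f : C -> C) (z : C) : C :=
  (RtoC (1 / 2) * (Dx f z + Ci * Dy f z))%C.

Definition lambda (f : C -> C) (z : C) : R :=
  Rabs (Cmod (Dz f z) - Cmod (Dzbar f z)).

(** [f] is represented by a total function but is only meaningful on its domain
    [D]; hence univalence in [S] includes that [f] is defined throughout [S].
    Values of the total function outside [D] never matter. *)
Definition univalent_in (D : C -> Prop) (f : C -> C) (S : C -> Prop) : Prop :=
  (forall z, S z -> D z) /\
  (forall z1 z2, S z1 -> S z2 -> f z1 = f z2 -> z1 = z2).

Definition image_contains (f : C -> C) (S T : C -> Prop) : Prop :=
  forall w, T w -> exists z, S z /\ f z = w.

Definition admissible (M : R) (g : C -> C) : Prop :=
  harmonic_on (disk 1) g /\
  g (RtoC 0) = RtoC 0 /\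
  lambda g (RtoC 0) - 1 = 0 /\
  (forall z, disk 1 z -> Cmod (g z) <= M).

Definition K (M : R) : R := Rmin (sqrt (2 * M ^ 2 - 2)) (4 * M / PI).

Definition r3 (M : R) : R := 1 / (1 + 2 * K M + sqrt (K M + 4 * K M ^ 2)).

(** The [else] branch is the case [M = 1]: no function is admissible for
    [M < 1]. *)
Definition sigma3 (M : R) : R :=
  if Rlt_dec 1 M then r3 M ^ 3 - K M * (r3 M ^ 4 / (1 - r3 M)) else 1.

Definition F (g : C -> C) (z : C) : C := (RtoC (Cmod z ^ 2) * g z)%C.

(* Main.v *)
From Stdlib Require Import Reals Lra Lia ZArith List Classical.
From Coquelicot Require Import Coquelicot.
Require Import Defs.
Open Scope R_scope.

(** Write [g = h + conj k] with [h], [k] holomorphic in the unit disk and let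
    [a n], [b n] be their Taylor coefficients.

    Coefficients. Testing [g] on a circle against a sum of two unimodular
    multiples of [exp (i n t)] and [exp (- i n t)], whose mean modulus is
    [4 / PI], gives [|a n| + |b n| <= 4 M / PI] ([coef_pair_bound]). Bessel's
    inequality ([bessel]) together with [|a 1|^2 + |b 1|^2 >= 1], which follows
    from [||a 1| - |b 1|| = 1], gives [|a n|^2 + |b n|^2 <= M^2 - 1] and hence
    [|a n| + |b n| <= sqrt (2 M^2 - 2)] for [n >= 2]. So all these sums are at
    most [K M]. The derivatives [f = g_z] and [e = conj g_zbar] are holomorphic
    with coefficients [(n + 1) a (n + 1)] and [(n + 1) b (n + 1)]
    ([coef_of_derivatives]), and Cauchy's formula, proved by shrinking a circle
    ([cauchy_kernel]) and expanded geometrically ([kernel_expansion]), yields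
    on [|z| = s]
      [|f z - f 0| + |e z - e 0| <= K M (1 / (1 - s)^2 - 1)]
    ([gradient_deviation]). Each estimate is made on a circle of radius
    [rho < 1] and [rho] tends to 1 at the end.

    Normalisation. Let [L] be the differential of [g] at 0. Its smallest
    singular value is [||a 1| - |b 1|| = 1], so [J = L^-1] does not increase
    norms, and [G = J o g] satisfies
      [|G z - z| <= K M s^2 / (1 - s)],
      [|dG z v - v| <= K M (1 / (1 - s)^2 - 1) |v|].
    Since [J] is linear over the reals, [J (|z|^2 g z) = |z|^2 G z], so that
    injectivity and covering may be proved for [|z|^2 G].

    Univalence. For [H z = |z|^2 G z] these two estimates give
      [<dH z v, v> >= s^2 |v|^2 (1 - K M (4 s / (1 - s) + s^2 / (1 - s)^2))]
    ([dF_coercive]), and [r3 M] is the radius up to which the bracket is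
    positive ([radius_condition]). Thus [H] is strictly monotone on the disk of
    radius [r3 M], in particular injective ([F_strictly_monotone]).

    Covering. On the circle [|z| = s] the radial component of [H] is at least
    [s^3 - K M s^4 / (1 - s)], which tends to [sigma3 M] as [s] tends to
    [r3 M]. If [|p| < sigma3 M], the monotone map [H - p] therefore points
    outwards on some circle, and a monotone Lipschitz map of a closed disk with
    this property has a zero ([monotone_zero]): the explicit Euler step of the
    flow of [- (H - p + eps z)] is a contraction of the disk.

    Sharpness. For [M = 1] one has [K M = 0] and [r3 M = sigma3 M = 1]; the
    identity is an example for [M = 1], it is given only on the unit disk, and
    its [F z = |z|^2 z] maps that disk into itself. *)

(** * Real differentials and the pair of holomorphic derivatives *)

Definition cont_at {U : UniformSpace} (G : U -> C) (x : U) : Prop :=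
  continuous (fun p => Re (G p)) x /\ continuous (fun p => Im (G p)) x.

Definition cderiv (G : R -> C) (t : R) (l : C) : Prop :=
  is_derive (fun s => Re (G s)) t (Re l) /\
  is_derive (fun s => Im (G s)) t (Im l).

(** The real differential of [f] at [z] is [v |-> a v + conj (b v)]. The second
    derivative is conjugated so that for a harmonic [f] both [a] and [b] depend
    holomorphically on [z]. *)
Definition wirtinger (f : C -> C) (z a b : C) : Prop :=
  differentiable_pt_lim (fun x y => Re (f (x, y))) (Re z) (Im z)
    (Re (a + Cconj b)%C) (Re (Ci * (a - Cconj b))%C) /\
  differentiable_pt_lim (fun x y => Im (f (x, y))) (Re z) (Im z)
    (Im (a + Cconj b)%C) (Im (Ci * (a - Cconj b))%C).

Definition holomorphic (D : C -> Prop) (f f' : C -> C) : Prop :=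
  forall z, D z -> wirtinger f z (f' z) 0 /\ cont_at f' z.

Definition harmonic_pair (D : C -> Prop) (g f e : C -> C) : Prop :=
  (forall z, D z -> wirtinger g z (f z) (e z)) /\
  (exists f', holomorphic D f f') /\ (exists e', holomorphic D e e').

Lemma C_ext (z w : C) : Re z = Re w -> Im z = Im w -> z = w.
Proof. destruct z, w; simpl; intros; subst; reflexivity. Qed.

Lemma Cmod_le_Rabs (z : C) : Cmod z <= Rabs (Re z) + Rabs (Im z).
Proof.
  replace z with (Cplus (RtoC (Re z)) (Cmult Ci (RtoC (Im z)))) at 1.
  2:{ apply C_ext; simpl; ring. }
  eapply Rle_trans; [apply Cmod_triangle|].
  rewrite Cmod_mult, Cmod_Ci, !Cmod_R. lra.
Qed.

Lemma disk_open (r : R) (z : C) : disk r z ->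
  locally_2d (fun x y => disk r (x, y)) (Re z) (Im z).
Proof.
  intros H. unfold disk in *.
  assert (Hd : 0 < (r - Cmod z) / 2) by lra.
  exists (mkposreal _ Hd). simpl. intros u v Hu Hv.
  replace (u, v) with (Cplus z (u - Re z, v - Im z)).
  2:{ destruct z; unfold Cplus; simpl; f_equal; ring. }
  eapply Rle_lt_trans; [apply Cmod_triangle|].
  pose proof (Cmod_le_Rabs (u - Re z, v - Im z)) as Huv.
  change (Cmod (u - Re z, v - Im z) <= Rabs (u - Re z) + Rabs (v - Im z)) in Huv.
  lra.
Qed.

Lemma ex_diff_1_differentiable (u : R -> R -> R) (x y : R) :
  locally_2d (fun a b => ex_diff_n u 1 a b) x y ->
  differentiable_pt_lim u x y (Derive (fun s => u s y) x)
    (Derive (fun s => u x s) y).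
Proof.
  intros H. apply filterdiff_differentiable_pt_lim.
  apply filterdiff_ext_lin with
    (fun p : R * R => plus (scal (fst p) (Derive (fun s => u s y) x))
                        (scal (snd p) (Derive (fun s => u x s) y))).
  2:{ intros p. reflexivity. }
  pose proof (locally_2d_singleton _ _ _ H) as Hxy.
  apply (is_derive_filterdiff u x y (fun a b => Derive (fun s => u s b) a)).
  - apply locally_2d_locally in H. revert H. apply filter_imp.
    intros p [_ [Hp _]]. now apply Derive_correct.
  - destruct Hxy as [_ [_ [Hp _]]]. now apply Derive_correct.
  - destruct Hxy as [_ [_ [_ [[Hp _] _]]]].
    now apply continuity_2d_pt_filterlim in Hp.
Qed.

(** The Laplace equation and the symmetry of the second derivatives are the
    Cauchy-Riemann equations of [u_x - i u_y]; here [p = u_xx] and [q = u_xy]. *)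
Lemma harmonic_gradient (r : R) (u : R -> R -> R) :
  harmonic_real_on (disk r) u ->
  exists p q : R -> R -> R, forall x y, disk r (x, y) ->
    differentiable_pt_lim u x y (Derive (fun s => u s y) x)
      (Derive (fun s => u x s) y) /\
    differentiable_pt_lim (fun a b => Derive (fun s => u s b) a) x y
      (p x y) (q x y) /\
    differentiable_pt_lim (fun a b => Derive (fun s => u a s) b) x y
      (q x y) (- p x y) /\
    continuity_2d_pt p x y /\ continuity_2d_pt q x y.
Proof.
  intros H.
  exists (fun x y => Derive (fun t => Derive (fun s => u s y) t) x),
    (fun x y => Derive (fun t => Derive (fun s => u s t) x) y).
  intros x y Hxy.
  assert (L : locally_2d (fun a b => ex_diff_n u 2 a b) x y).
  { generalize (disk_open r (x, y) Hxy). apply locally_2d_impl.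
    apply locally_2d_forall. intros a b Hab. apply (H a b Hab). }
  assert (Sc : Derive (fun t => Derive (fun s => u t s) y) x =
               Derive (fun t => Derive (fun s => u s t) x) y).
  { apply Schwarz.
    - revert L. apply locally_2d_impl, locally_2d_forall.
      intros a b [_ [h1 [h2 [[_ [_ [h3 _]]] [_ [h4 _]]]]]]. auto.
    - destruct (locally_2d_singleton _ _ _ L) as
        [_ [_ [_ [_ [_ [_ [_ [[h _] _]]]]]]]]. exact h.
    - destruct (locally_2d_singleton _ _ _ L) as
        [_ [_ [_ [[_ [_ [_ [_ [h _]]]]] _]]]]. exact h. }
  split; [|split; [|split; [|split]]].
  - apply ex_diff_1_differentiable. revert L.
    apply locally_2d_impl, locally_2d_forall. intros a b Hab.
    now apply (ex_diff_n_m 2); [lia|].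
  - apply (ex_diff_1_differentiable (fun a b => Derive (fun s => u s b) a)).
    revert L. apply locally_2d_impl, locally_2d_forall. intros a b Hab.
    apply Hab.
  - rewrite <- Sc.
    replace (- Derive (fun t => Derive (fun s => u s y) t) x)
      with (Derive (fun t => Derive (fun s => u x s) t) y).
    2:{ destruct (H x y Hxy) as [_ E]. unfold partial_derive in E.
        simpl in E. rewrite <- (Rplus_0_r (- _)), <- E.
        change (fun x => u x y) with (fun s => u s y). ring. }
    apply (ex_diff_1_differentiable (fun a b => Derive (fun s => u a s) b)).
    revert L. apply locally_2d_impl, locally_2d_forall. intros a b Hab.
    apply Hab.
  - destruct (locally_2d_singleton _ _ _ L) as
      [_ [_ [_ [[_ [_ [_ [[h _] _]]]] _]]]]. exact h.
  - destruct (locally_2d_singleton _ _ _ L) as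
      [_ [_ [_ [[_ [_ [_ [_ [h _]]]]] _]]]]. exact h.
Qed.

Lemma differentiable_lin (a b : R) (p q : R -> R -> R) (x y px py qx qy : R) :
  differentiable_pt_lim p x y px py -> differentiable_pt_lim q x y qx qy ->
  differentiable_pt_lim (fun s t => a * p s t + b * q s t) x y
    (a * px + b * qx) (a * py + b * qy).
Proof.
  intros Hp Hq.
  apply (differentiable_pt_lim_comp (fun s t => a * s + b * t) p q); auto.
  intros eps. apply locally_2d_forall. intros s t.
  replace (_ - _) with 0 by ring. rewrite Rabs_R0.
  apply Rmult_le_pos; [apply Rlt_le, cond_pos|].
  eapply Rle_trans; [apply Rabs_pos|apply Rmax_l].
Qed.

Lemma continuity_2d_lin (a b : R) (p q : R -> R -> R) (x y : R) :
  continuity_2d_pt p x y -> continuity_2d_pt q x y ->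
  continuity_2d_pt (fun s t => a * p s t + b * q s t) x y.
Proof.
  intros Hp Hq. apply continuity_2d_pt_plus;
    (apply continuity_2d_pt_mult; [apply continuity_2d_pt_const|assumption]).
Qed.

(** Closes a differentiability goal whose partial derivatives agree with those
    of [E] up to field identities. *)
Ltac match_partials E :=
  match type of E with differentiable_pt_lim _ _ _ ?a ?b =>
  match goal with |- differentiable_pt_lim _ _ _ ?c ?d =>
    replace c with a; [replace d with b; [exact E|]|];
    simpl; unfold Re, Im; field
  end end.

(** For [g = u + i v] the two derivatives are half the sum and half the
    difference of [u_x - i u_y] and [i (v_x - i v_y)], both holomorphic. *)
Lemma harmonic_pair_of_harmonic (r : R) (g : C -> C) :
  harmonic_on (disk r) g ->
  harmonic_pair (disk r) g (Dz g) (fun z => Cconj (Dzbar g z)).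
Proof.
  intros [Hu Hv].
  apply harmonic_gradient in Hu, Hv.
  destruct Hu as [p [q Hu]], Hv as [s [t Hv]].
  split; [|split].
  - intros [x y] Hz. destruct (Hu x y Hz) as [h _], (Hv x y Hz) as [k _].
    unfold wirtinger. split; simpl.
    + match_partials h.
    + match_partials k.
  - exists (fun z => (/2 * p (Re z) (Im z) + /2 * t (Re z) (Im z),
                   /2 * s (Re z) (Im z) + (-/2) * q (Re z) (Im z))).
    intros [x y] Hz. destruct (Hu x y Hz) as [_ [h1 [h2 [h3 h4]]]].
    destruct (Hv x y Hz) as [_ [k1 [k2 [k3 k4]]]].
    split; [|split].
    + split; simpl.
      * pose proof (differentiable_lin (/2) (/2) _ _ _ _ _ _ _ _ h1 k2) as E.
        eapply differentiable_pt_lim_ext in E.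
        2:{ apply locally_2d_forall. intros a b.
            instantiate (1 := fun x y => Re (Dz g (x, y))). simpl. field. }
        match_partials E.
      * pose proof (differentiable_lin (/2) (-/2) _ _ _ _ _ _ _ _ k1 h2) as E.
        eapply differentiable_pt_lim_ext in E.
        2:{ apply locally_2d_forall. intros a b.
            instantiate (1 := fun x y => Im (Dz g (x, y))). simpl. field. }
        match_partials E.
    + apply (proj1 (continuity_2d_pt_filterlim (fun x y => /2 * p x y + /2 * t x y) x y)).
      now apply continuity_2d_lin.
    + apply (proj1 (continuity_2d_pt_filterlim (fun x y => /2 * s x y + (-/2) * q x y) x y)).
      now apply continuity_2d_lin.
  - exists (fun z => (/2 * p (Re z) (Im z) + (-/2) * t (Re z) (Im z),
                   (-/2) * s (Re z) (Im z) + (-/2) * q (Re z) (Im z))).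
    intros [x y] Hz. destruct (Hu x y Hz) as [_ [h1 [h2 [h3 h4]]]].
    destruct (Hv x y Hz) as [_ [k1 [k2 [k3 k4]]]].
    split; [|split].
    + split; simpl.
      * pose proof (differentiable_lin (/2) (-/2) _ _ _ _ _ _ _ _ h1 k2) as E.
        eapply differentiable_pt_lim_ext in E.
        2:{ apply locally_2d_forall. intros a b.
            instantiate (1 := fun x y => Re (Cconj (Dzbar g (x, y)))). simpl. field. }
        match_partials E.
      * pose proof (differentiable_lin (-/2) (-/2) _ _ _ _ _ _ _ _ k1 h2) as E.
        eapply differentiable_pt_lim_ext in E.
        2:{ apply locally_2d_forall. intros a b.
            instantiate (1 := fun x y => Im (Cconj (Dzbar g (x, y)))). simpl. field. }
        match_partials E.
    + apply (proj1 (continuity_2d_pt_filterlim (fun x y => /2 * p x y + (-/2) * t x y) x y)).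
      now apply continuity_2d_lin.
    + apply (proj1 (continuity_2d_pt_filterlim (fun x y => (-/2) * s x y + (-/2) * q x y) x y)).
      now apply continuity_2d_lin.
Qed.

(** * Complex-valued functions of a real variable *)

Section Continuity.
Context {U : UniformSpace}.
Implicit Types (G H : U -> C) (x : U).

Lemma cont_at_ext G H x : (forall p, G p = H p) -> cont_at G x -> cont_at H x.
Proof.
  intros E [h1 h2]; split.
  - eapply continuous_ext; [intro; simpl; now rewrite <- E|exact h1].
  - eapply continuous_ext; [intro; simpl; now rewrite <- E|exact h2].
Qed.

Lemma cont_at_const (c : C) x : cont_at (fun _ => c) x.
Proof. split; apply continuous_const. Qed.

Lemma cont_at_plus G H x :
  cont_at G x -> cont_at H x -> cont_at (fun p => (G p + H p)%C) x.
Proof.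
  intros [h1 h2] [k1 k2]; split; simpl.
  - apply (continuous_plus (V := R_NormedModule) _ _ x h1 k1).
  - apply (continuous_plus (V := R_NormedModule) _ _ x h2 k2).
Qed.

Lemma cont_at_mult G H x :
  cont_at G x -> cont_at H x -> cont_at (fun p => (G p * H p)%C) x.
Proof.
  intros [h1 h2] [k1 k2]; split; simpl.
  - apply (continuous_minus (V := R_NormedModule)
             (fun p => Re (G p) * Re (H p)) (fun p => Im (G p) * Im (H p)));
      apply (continuous_mult (K := R_AbsRing)); assumption.
  - apply (continuous_plus (V := R_NormedModule)
             (fun p => Re (G p) * Im (H p)) (fun p => Im (G p) * Re (H p)));
      apply (continuous_mult (K := R_AbsRing)); assumption.
Qed.

Lemma cont_at_conj G x : cont_at G x -> cont_at (fun p => Cconj (G p)) x.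
Proof.
  intros [h1 h2]; split; simpl; auto.
  now apply (continuous_opp (V := R_NormedModule) (fun p => Im (G p))).
Qed.

Lemma cont_at_comp (f : C -> C) G x :
  cont_at f (G x) -> cont_at G x -> cont_at (fun p => f (G p)) x.
Proof.
  intros [h1 h2] [k1 k2].
  assert (E : forall p, f (G p) = f (Re (G p), Im (G p)))
    by (intro p; now destruct (G p)).
  apply cont_at_ext with (fun p => f (Re (G p), Im (G p)));
    [intro p; now rewrite E|].
  split.
  - apply (continuous_comp_2 (fun p => Re (G p)) (fun p => Im (G p))
             (fun a b => Re (f (a, b)))); auto.
    eapply continuous_ext with (f := fun z : C => Re (f z));
      [intros [a b]; reflexivity|]. now destruct (G x).
  - apply (continuous_comp_2 (fun p => Re (G p)) (fun p => Im (G p))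
             (fun a b => Im (f (a, b)))); auto.
    eapply continuous_ext with (f := fun z : C => Im (f z));
      [intros [a b]; reflexivity|]. now destruct (G x).
Qed.

Lemma cont_at_inv G x :
  G x <> 0%C -> cont_at G x -> cont_at (fun p => (/ G p)%C) x.
Proof.
  intros Hx [h1 h2].
  assert (N : Re (G x) ^ 2 + Im (G x) ^ 2 <> 0).
  { rewrite <- Cmod2_alt. apply pow_nonzero. intro E. now apply Cmod_eq_0 in E. }
  assert (D : continuous (fun p => / (Re (G p) ^ 2 + Im (G p) ^ 2)) x).
  { apply (continuous_comp (fun p => Re (G p) ^ 2 + Im (G p) ^ 2) Rinv).
    - apply (continuous_plus (V := R_NormedModule));
        apply (continuous_mult (K := R_AbsRing)); auto;
        (apply (continuous_mult (K := R_AbsRing)); auto; apply continuous_const).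
    - apply continuity_pt_filterlim.
      apply continuity_pt_inv; [apply continuity_pt_id|exact N]. }
  split; simpl.
  - now apply (continuous_mult (K := R_AbsRing)).
  - apply (continuous_mult (K := R_AbsRing)); auto.
    now apply (continuous_opp (V := R_NormedModule) (fun p => Im (G p))).
Qed.

End Continuity.

Definition ccont (G : R -> C) : Prop := forall t : R, cont_at G t.

Lemma cderiv_cont (G : R -> C) (t : R) (l : C) : cderiv G t l -> cont_at G t.
Proof.
  intros [h1 h2]; split;
    apply (ex_derive_continuous (K := R_AbsRing) (V := R_NormedModule));
    eexists; eassumption.
Qed.

Lemma cderiv_ext (G H : R -> C) (t : R) (l : C) :
  (forall s, G s = H s) -> cderiv G t l -> cderiv H t l.
Proof.
  intros E [h1 h2]; split.
  - eapply is_derive_ext; [intro; simpl; now rewrite <- E|exact h1].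
  - eapply is_derive_ext; [intro; simpl; now rewrite <- E|exact h2].
Qed.

Lemma cderiv_const (c : C) (t : R) : cderiv (fun _ => c) t 0.
Proof. split; simpl; apply (is_derive_const (V := R_NormedModule)). Qed.

Lemma cderiv_plus (G H : R -> C) (t : R) (l m : C) :
  cderiv G t l -> cderiv H t m -> cderiv (fun s => (G s + H s)%C) t (l + m)%C.
Proof.
  intros [h1 h2] [k1 k2]; split; simpl;
    now apply (is_derive_plus (V := R_NormedModule)).
Qed.

Lemma cderiv_mult (G H : R -> C) (t : R) (l m : C) :
  cderiv G t l -> cderiv H t m ->
  cderiv (fun s => (G s * H s)%C) t (l * H t + G t * m)%C.
Proof.
  intros [h1 h2] [k1 k2].
  apply is_derive_Reals in h1, h2, k1, k2.
  split; apply is_derive_Reals.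
  - replace (Re (l * H t + G t * m)%C)
      with ((Re l * Re (H t) + Re (G t) * Re m) - (Im l * Im (H t) + Im (G t) * Im m))
      by (simpl; unfold Re, Im; ring).
    exact (derivable_pt_lim_minus _ _ _ _ _
             (derivable_pt_lim_mult _ _ _ _ _ h1 k1)
             (derivable_pt_lim_mult _ _ _ _ _ h2 k2)).
  - replace (Im (l * H t + G t * m)%C)
      with ((Re l * Im (H t) + Re (G t) * Im m) + (Im l * Re (H t) + Im (G t) * Re m))
      by (simpl; unfold Re, Im; ring).
    exact (derivable_pt_lim_plus _ _ _ _ _
             (derivable_pt_lim_mult _ _ _ _ _ h1 k2)
             (derivable_pt_lim_mult _ _ _ _ _ h2 k1)).
Qed.

Lemma cderiv_RtoC (h : R -> R) (t l : R) :
  is_derive h t l -> cderiv (fun s => RtoC (h s)) t (RtoC l).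
Proof. intros H; split; simpl; [exact H|apply (is_derive_const (V := R_NormedModule))]. Qed.

Lemma wirtinger_chain (f : C -> C) (G : R -> C) (t : R) (l a b : C) :
  wirtinger f (G t) a b -> cderiv G t l ->
  cderiv (fun s => f (G s)) t (a * l + Cconj (b * l))%C.
Proof.
  intros [h1 h2] [k1 k2].
  apply cderiv_ext with (fun s => f (Re (G s), Im (G s)));
    [intro s; now destruct (G s)|].
  apply is_derive_Reals in k1, k2.
  split; apply is_derive_Reals.
  - pose proof (derivable_pt_lim_comp_2d _ _ _ _ _ _ _ _ h1 k1 k2) as E.
    match type of E with derivable_pt_lim _ _ ?u =>
    match goal with |- derivable_pt_lim _ _ ?v => replace v with u end end;
    [exact E|]. simpl. unfold Re, Im. ring.
  - pose proof (derivable_pt_lim_comp_2d _ _ _ _ _ _ _ _ h2 k1 k2) as E.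
    match type of E with derivable_pt_lim _ _ ?u =>
    match goal with |- derivable_pt_lim _ _ ?v => replace v with u end end;
    [exact E|]. simpl. unfold Re, Im. ring.
Qed.

Lemma holomorphic_chain (D : C -> Prop) (f f' : C -> C) (G : R -> C) (t : R) (l : C) :
  holomorphic D f f' -> D (G t) -> cderiv G t l ->
  cderiv (fun s => f (G s)) t (f' (G t) * l)%C.
Proof.
  intros H HD HG.
  replace (f' (G t) * l)%C with (f' (G t) * l + Cconj (0 * l))%C.
  - apply wirtinger_chain; auto. now apply H.
  - apply C_ext; simpl; ring.
Qed.

(** * Integrals over a period and characters of the circle *)

Definition CInt (G : R -> C) : C :=
  (RInt (fun t => Re (G t)) 0 (2 * PI), RInt (fun t => Im (G t)) 0 (2 * PI)).

Lemma cont_RInt (h : R -> R) (a b : R) :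
  (forall t : R, continuous h t) -> ex_RInt h a b.
Proof. intros H. apply (ex_RInt_continuous (V := R_CompleteNormedModule)). auto. Qed.

Lemma two_PI_pos : 0 < 2 * PI.
Proof. pose proof PI_RGT_0; lra. Qed.

Lemma CInt_ext (G H : R -> C) : (forall t, G t = H t) -> CInt G = CInt H.
Proof. intros E. apply C_ext; simpl; apply RInt_ext; intros; now rewrite E. Qed.

Lemma CInt_plus (G H : R -> C) : ccont G -> ccont H ->
  CInt (fun t => (G t + H t)%C) = (CInt G + CInt H)%C.
Proof.
  intros HG HH. apply C_ext.
  - exact (RInt_plus (V := R_CompleteNormedModule) _ _ _ _
      (cont_RInt _ _ _ (fun t => proj1 (HG t)))
      (cont_RInt _ _ _ (fun t => proj1 (HH t)))).
  - exact (RInt_plus (V := R_CompleteNormedModule) _ _ _ _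
      (cont_RInt _ _ _ (fun t => proj2 (HG t)))
      (cont_RInt _ _ _ (fun t => proj2 (HH t)))).
Qed.

Lemma CInt_scal (c : C) (G : R -> C) : ccont G ->
  CInt (fun t => (c * G t)%C) = (c * CInt G)%C.
Proof.
  intros HG.
  assert (E1 : ex_RInt (fun t => Re (G t)) 0 (2 * PI)) by exact (cont_RInt _ _ _ (fun t => proj1 (HG t))).
  assert (E2 : ex_RInt (fun t => Im (G t)) 0 (2 * PI)) by exact (cont_RInt _ _ _ (fun t => proj2 (HG t))).
  apply C_ext; simpl.
  - rewrite (RInt_minus (V := R_CompleteNormedModule) (fun t => Re c * Re (G t))
      (fun t => Im c * Im (G t))).
    + rewrite !(RInt_scal (V := R_CompleteNormedModule)); auto.
    + now apply (ex_RInt_scal (V := R_CompleteNormedModule)).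
    + now apply (ex_RInt_scal (V := R_CompleteNormedModule)).
  - rewrite (RInt_plus (V := R_CompleteNormedModule) (fun t => Re c * Im (G t))
      (fun t => Im c * Re (G t))).
    + rewrite !(RInt_scal (V := R_CompleteNormedModule)); auto.
    + now apply (ex_RInt_scal (V := R_CompleteNormedModule)).
    + now apply (ex_RInt_scal (V := R_CompleteNormedModule)).
Qed.

Lemma CInt_conj (G : R -> C) : ccont G ->
  CInt (fun t => Cconj (G t)) = Cconj (CInt G).
Proof.
  intros HG. apply C_ext; simpl; auto.
  apply (RInt_opp (V := R_CompleteNormedModule)).
  apply cont_RInt; intro; apply HG.
Qed.

Lemma CInt_const (c : C) : CInt (fun _ => c) = (RtoC (2 * PI) * c)%C.
Proof.
  apply C_ext; simpl; rewrite (RInt_const (V := R_CompleteNormedModule));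
  unfold scal; simpl; unfold mult; simpl; unfold Re, Im; ring.
Qed.

Lemma CInt_ftc (G G' : R -> C) : (forall t, cderiv G t (G' t)) -> ccont G' ->
  CInt G' = (G (2 * PI)%R - G 0%R)%C.
Proof.
  intros H HC. apply C_ext; apply is_RInt_unique.
  - exact (is_RInt_derive (V := R_CompleteNormedModule) (fun t => Re (G t))
      (fun t => Re (G' t)) 0 (2 * PI)
      (fun t _ => proj1 (H t)) (fun t _ => proj1 (HC t))).
  - exact (is_RInt_derive (V := R_CompleteNormedModule) (fun t => Im (G t))
      (fun t => Im (G' t)) 0 (2 * PI)
      (fun t _ => proj2 (H t)) (fun t _ => proj2 (HC t))).
Qed.

Definition dot (z w : C) : R := Re z * Re w + Im z * Im w.

Lemma dot_self (z : C) : dot z z = Cmod z ^ 2.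
Proof. rewrite Cmod2_alt. unfold dot. ring. Qed.

Lemma dot_Re (z w : C) : dot z w = Re (Cconj z * w)%C.
Proof. unfold dot; simpl; unfold Re, Im; ring. Qed.

Lemma dot_abs_le (z w : C) : Rabs (dot z w) <= Cmod z * Cmod w.
Proof.
  rewrite dot_Re, <- (Cmod_conj z), <- Cmod_mult. apply re_le_Cmod.
Qed.

Lemma dot_le (z w : C) : dot z w <= Cmod z * Cmod w.
Proof. eapply Rle_trans; [apply Rle_abs|apply dot_abs_le]. Qed.

Lemma cont_dot (c : C) (G : R -> C) : ccont G ->
  forall t : R, continuous (fun s => dot c (G s)) t.
Proof.
  intros H t. destruct (H t) as [h1 h2].
  apply (continuous_plus (V := R_NormedModule)
    (fun s => Re c * Re (G s)) (fun s => Im c * Im (G s)));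
  (apply (continuous_mult (K := R_AbsRing)); [apply continuous_const|assumption]).
Qed.

Lemma CInt_dot (c : C) (G : R -> C) : ccont G ->
  dot c (CInt G) = RInt (fun t => dot c (G t)) 0 (2 * PI).
Proof.
  intros HG. rewrite dot_Re, <- CInt_scal; auto. simpl.
  apply RInt_ext. intros. unfold dot; simpl; unfold Re, Im; ring.
Qed.

Lemma Cmod_le_dot (z : C) (B : R) : 0 <= B ->
  (dot z z <= B * Cmod z) -> Cmod z <= B.
Proof.
  intros HB H. rewrite dot_self in H.
  destruct (Req_dec (Cmod z) 0) as [E|E]; [lra|].
  pose proof (Cmod_ge_0 z).
  apply Rmult_le_reg_r with (Cmod z); lra.
Qed.

(** The square of [|CInt G|] is the integral of the inner product of the
    vector [CInt G] with [G t], which is at most [|CInt G| B] pointwise. *)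
Lemma CInt_bound (G : R -> C) (B : R) : ccont G ->
  (forall t, 0 <= t <= 2 * PI -> Cmod (G t) <= B) -> Cmod (CInt G) <= 2 * PI * B.
Proof.
  intros HG HB. pose proof two_PI_pos.
  assert (0 <= B) by (eapply Rle_trans; [apply Cmod_ge_0|apply (HB 0); lra]).
  apply Cmod_le_dot; [nra|].
  rewrite CInt_dot at 1 by auto.
  replace (2 * PI * B * Cmod (CInt G)) with
    (RInt (fun _ => Cmod (CInt G) * B) 0 (2 * PI)).
  2:{ rewrite (RInt_const (V := R_CompleteNormedModule)).
      unfold scal; simpl; unfold mult; simpl; ring. }
  apply RInt_le; [lra|apply cont_RInt, cont_dot; auto|
                  apply cont_RInt; intro; apply continuous_const|].
  intros t Ht. eapply Rle_trans; [apply dot_le|].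
  apply Rmult_le_compat_l; [apply Cmod_ge_0|apply HB; lra].
Qed.

Lemma CInt_param (G G' : R -> R -> C) (x : R) :
  locally x (fun l : R => forall t, cderiv (fun s => G s t) l (G' l t)) ->
  (forall t : R, cont_at (fun p : R * R => G' (fst p) (snd p)) (x, t)) ->
  locally x (fun l : R => ccont (G l)) ->
  cderiv (fun l => CInt (G l)) x (CInt (G' x)).
Proof.
  intros H1 H2 H3.
  assert (Hx : forall t, cderiv (fun s => G s t) x (G' x t))
    by now apply locally_singleton in H1.
  split.
  - replace (Re (CInt (G' x))) with
      (RInt (fun t => Derive (fun u => Re (G u t)) x) 0 (2 * PI)).
    2:{ apply RInt_ext; intros t _. apply is_derive_unique. exact (proj1 (Hx t)). }
    apply (is_derive_RInt_param (fun l t => Re (G l t))).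
    + revert H1. apply filter_imp. intros l Hl t _.
      exists (Re (G' l t)). exact (proj1 (Hl t)).
    + intros t _. apply continuity_2d_pt_ext_loc with (fun l s => Re (G' l s)).
      * destruct H1 as [d Hd]. exists d. intros u v Hu _. symmetry.
        apply is_derive_unique. exact (proj1 (Hd u Hu v)).
      * apply continuity_2d_pt_filterlim. exact (proj1 (H2 t)).
    + revert H3. apply filter_imp. intros l Hl. apply cont_RInt.
      intro t. exact (proj1 (Hl t)).
  - replace (Im (CInt (G' x))) with
      (RInt (fun t => Derive (fun u => Im (G u t)) x) 0 (2 * PI)).
    2:{ apply RInt_ext; intros t _. apply is_derive_unique. exact (proj2 (Hx t)). }
    apply (is_derive_RInt_param (fun l t => Im (G l t))).
    + revert H1. apply filter_imp. intros l Hl t _.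
      exists (Im (G' l t)). exact (proj2 (Hl t)).
    + intros t _. apply continuity_2d_pt_ext_loc with (fun l s => Im (G' l s)).
      * destruct H1 as [d Hd]. exists d. intros u v Hu _. symmetry.
        apply is_derive_unique. exact (proj2 (Hd u Hu v)).
      * apply continuity_2d_pt_filterlim. exact (proj2 (H2 t)).
    + revert H3. apply filter_imp. intros l Hl. apply cont_RInt.
      intro t. exact (proj2 (Hl t)).
Qed.


Definition cis (t : R) : C := (cos t, sin t).

Lemma cis_plus (s t : R) : cis (s + t) = (cis s * cis t)%C.
Proof.
  apply C_ext; simpl; [rewrite cos_plus; ring|rewrite sin_plus; ring].
Qed.

Lemma cis_conj (t : R) : Cconj (cis t) = cis (- t).
Proof. apply C_ext; simpl; [now rewrite cos_neg|now rewrite sin_neg]. Qed.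

Lemma Cmod_cis (t : R) : Cmod (cis t) = 1.
Proof.
  unfold Cmod. rewrite <- sqrt_1 at 1. f_equal. unfold cis, fst, snd.
  rewrite <- (sin2_cos2 t). unfold Rsqr. ring.
Qed.

Lemma cis_nonzero (t : R) : cis t <> 0%C.
Proof. apply Cmod_gt_0. rewrite Cmod_cis; lra. Qed.

Lemma cis_0 : cis 0 = 1%C.
Proof. apply C_ext; simpl; [apply cos_0|apply sin_0]. Qed.

Lemma cderiv_cis (k t : R) :
  cderiv (fun s => cis (k * s)) t (RtoC k * Ci * cis (k * t))%C.
Proof.
  split; simpl; auto_derive; auto; ring.
Qed.

Lemma ccont_cis (k : R) : ccont (fun s => cis (k * s)).
Proof. intros t. eapply cderiv_cont, cderiv_cis. Qed.

Lemma cis_period (k : Z) : cis (IZR k * (2 * PI)) = 1%C.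
Proof.
  assert (P : forall n, cis (INR n * (2 * PI)) = 1%C).
  { intros n. rewrite <- cis_0. apply C_ext; simpl.
    - rewrite <- (cos_period 0 n). f_equal; ring.
    - rewrite <- (sin_period 0 n). f_equal; ring. }
  destruct (ZArith_dec.Z_le_dec 0 k) as [Hk|Hk].
  - rewrite <- (Z2Nat.id k), <- INR_IZR_INZ by lia. apply P.
  - replace (IZR k * (2 * PI)) with (- (INR (Z.to_nat (- k)) * (2 * PI))).
    + rewrite <- cis_conj, P. apply C_ext; simpl; ring.
    + rewrite INR_IZR_INZ, Z2Nat.id, opp_IZR by lia. ring.
Qed.

Lemma CInt_cis (k : Z) :
  CInt (fun t => cis (IZR k * t)) = RtoC (if Z.eq_dec k 0 then 2 * PI else 0).
Proof.
  destruct (Z.eq_dec k 0) as [->|Hk].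
  - rewrite (CInt_ext _ (fun _ => 1%C)), CInt_const.
    + apply C_ext; simpl; ring.
    + intros t. rewrite Rmult_0_l. apply cis_0.
  - assert (Hk' : IZR k <> 0) by now apply not_0_IZR.
    assert (E : CInt (fun t => (RtoC (IZR k) * Ci * cis (IZR k * t))%C) = 0%C).
    { rewrite (CInt_ftc (fun t => cis (IZR k * t))).
      - rewrite cis_period, Rmult_0_r, cis_0. apply C_ext; simpl; ring.
      - intro; apply cderiv_cis.
      - intro t. apply cont_at_mult; [apply cont_at_const|apply ccont_cis]. }
    rewrite CInt_scal in E by apply ccont_cis.
    set (I := CInt (fun t => cis (IZR k * t))) in *.
    pose proof (f_equal Re E) as E1. pose proof (f_equal Im E) as E2.
    simpl in E1, E2. change (fst I) with (Re I) in *. change (snd I) with (Im I) in *.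
    set (c := IZR k) in *. clearbody c.
    apply C_ext; simpl; apply Rmult_eq_reg_l with c; auto; nra.
Qed.

(** * Homotopy form of Cauchy's formula *)

Lemma cont_at_precomp {U V : UniformSpace} (G : V -> C) (h : U -> V) (x : U) :
  cont_at G (h x) -> continuous h x -> cont_at (fun p => G (h p)) x.
Proof.
  intros [h1 h2] H; split.
  - now apply (continuous_comp h (fun v => Re (G v))).
  - now apply (continuous_comp h (fun v => Im (G v))).
Qed.

Lemma cderiv_eq (G : R -> C) (t : R) (l m : C) :
  l = m -> cderiv G t l -> cderiv G t m.
Proof. now intros ->. Qed.

Lemma cderiv_segment (z v : C) (t : R) :
  cderiv (fun l => (z + RtoC l * v)%C) t v.
Proof.
  apply cderiv_eq with (0 + (RtoC 1 * v + RtoC t * 0))%C; [ring|].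
  apply cderiv_plus; [apply cderiv_const|].
  apply cderiv_mult; [|apply cderiv_const].
  apply cderiv_RtoC. apply (is_derive_id (K := R_AbsRing)).
Qed.

Lemma cderiv_circle (z : C) (l t : R) :
  cderiv (fun s => (z + RtoC l * (cis (1 * s) - z))%C) t
    (RtoC l * (RtoC 1 * Ci * cis (1 * t)))%C.
Proof.
  eapply cderiv_eq;
    [|exact (cderiv_plus _ _ _ _ _ (cderiv_const z t)
        (cderiv_mult _ _ _ _ _ (cderiv_const (RtoC l) t)
          (cderiv_plus _ _ _ _ _ (cderiv_cis 1 t) (cderiv_const (- z)%C t))))].
  cbv beta. ring.
Qed.

(** Vanishing is asked for [l > 0] only: the homotopy below degenerates at
    [l = 0] to a point, and its derivative is computed by dividing by [l]. *)
Lemma constant_of_zero_derivative (G : R -> C) (G' : R -> C) :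
  (forall l, 0 <= l <= 1 -> cderiv G l (G' l)) ->
  (forall l, 0 < l <= 1 -> G' l = 0%C) -> G 1 = G 0.
Proof.
  intros H H0.
  assert (E : forall (p : C -> R) , p 0%C = 0 ->
    (forall l, 0 <= l <= 1 -> is_derive (fun s => p (G s)) l (p (G' l))) ->
    p (G 1) = p (G 0)).
  { intros p p0 D.
    destruct (MVT_gen (fun s => p (G s)) 0 1 (fun _ => 0)) as [c [_ Hc]].
    - rewrite Rmin_left, Rmax_right by lra. intros l Hl.
      rewrite <- p0, <- (H0 l) by lra. apply D; lra.
    - rewrite Rmin_left, Rmax_right by lra. intros l Hl.
      apply continuity_pt_filterlim.
      apply (ex_derive_continuous (K := R_AbsRing) (V := R_NormedModule)).
      eexists. apply D; lra.
    - lra. }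
  apply C_ext; apply E; simpl; auto; intros; now apply H.
Qed.

(** The circle shrinks to [z] along [w l t = z + l (cis t - z)]. The factor
    [cis t - z] that the derivative in [l] produces is cancelled by [k], so the
    integral has derivative [CInt (f' (w l t) cis t)], and for [l > 0] the
    integrand is the derivative in [t] of [f (w l t) / (i l)], of integral 0
    over the closed curve. *)
Lemma cauchy_kernel (r : R) (f f' : C -> C) (z : C) (k : R -> C) :
  1 < r -> holomorphic (disk r) f f' -> Cmod z < 1 -> ccont k ->
  (forall t, (k t * (cis t - z))%C = cis t) ->
  CInt (fun t => (f (cis t) * k t)%C) = (f z * CInt k)%C.
Proof.
  intros Hr Hf Hz Hk Hkz.
  set (w := fun (l t : R) => (z + RtoC l * (cis (1 * t) - z))%C).
  assert (Hw : forall l0, 0 <= l0 <= 1 ->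
    locally l0 (fun l => forall t, disk r (w l t))).
  { intros l0 Hl0. assert (Hd : 0 < (r - 1) / 2) by lra.
    exists (mkposreal _ Hd). intros l Hl t.
    change (Rabs (l - l0) < (r - 1) / 2) in Hl. unfold disk, w.
    replace (z + RtoC l * (cis (1 * t) - z))%C with
      (RtoC (1 - l) * z + RtoC l * cis (1 * t))%C by (rewrite RtoC_minus; ring).
    eapply Rle_lt_trans; [apply Cmod_triangle|].
    rewrite !Cmod_mult, !Cmod_R, Cmod_cis.
    pose proof (Cmod_ge_0 z).
    assert (Rabs (1 - l) <= 1 - l0 + (r - 1) / 2)
      by (apply Rabs_le_between; apply Rabs_lt_between in Hl; lra).
    assert (Rabs l <= l0 + (r - 1) / 2)
      by (apply Rabs_le_between; apply Rabs_lt_between in Hl; lra).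
    pose proof (Rabs_pos (1 - l)). nra. }
  assert (Hw0 : forall l t, 0 <= l <= 1 -> disk r (w l t)).
  { intros l t Hl. specialize (Hw l Hl). now apply locally_singleton in Hw. }
  assert (Dt : forall l t, disk r (w l t) -> cderiv (fun s => f (w l s)) t
     (f' (w l t) * (RtoC l * (RtoC 1 * Ci * cis (1 * t))))%C).
  { intros l t Hl. apply (holomorphic_chain (disk r)); auto. apply cderiv_circle. }
  assert (Cf' : forall l t, 0 <= l <= 1 ->
     cont_at (fun p : R * R => (f' (w (fst p) (snd p)) * cis (1 * snd p))%C) (l, t)).
  { intros l t Hl.
    assert (Cs : cont_at (fun p : R * R => cis (1 * snd p)) (l, t)).
    { apply (cont_at_precomp (fun s : R => cis (1 * s)) (snd : R * R -> R)).
      - apply (ccont_cis 1).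
      - apply (continuous_snd (U := R_UniformSpace) (V := R_UniformSpace)). }
    apply cont_at_mult; auto.
    apply (cont_at_comp f' (fun p : R * R => w (fst p) (snd p))).
    - apply (Hf (w l t)). auto.
    - apply cont_at_plus; [apply cont_at_const|]. apply cont_at_mult.
      + apply (cont_at_precomp (fun s : R => RtoC s) (fst : R * R -> R)).
        * split; simpl; [apply continuous_id|apply continuous_const].
        * apply (continuous_fst (U := R_UniformSpace) (V := R_UniformSpace)).
      + apply cont_at_plus; auto. apply cont_at_const. }
  set (G' := fun l t => (f' (w l t) * cis (1 * t))%C).
  assert (E : CInt (fun t => (f (w 1 t) * k t)%C) = CInt (fun t => (f (w 0 t) * k t)%C)).
  { apply (constant_of_zero_derivative (fun l => CInt (fun t => (f (w l t) * k t)%C))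
       (fun l => CInt (G' l))).
    - intros l Hl. apply (CInt_param (fun l t => (f (w l t) * k t)%C) G').
      + generalize (Hw l Hl). apply filter_imp. intros s Hs t.
        unfold G'.
        apply cderiv_eq with (f' (w s t) * (cis (1 * t) - z) * k t + f (w s t) * 0)%C.
        { rewrite Rmult_1_l. transitivity (f' (w s t) * (k t * (cis t - z)))%C;
            [ring|now rewrite Hkz]. }
        apply (cderiv_mult (fun s => f (w s t)) (fun _ => k t)); [|apply cderiv_const].
        apply (holomorphic_chain (disk r) f f' (fun s => w s t)); auto.
        apply cderiv_segment.
      + intros t. apply (Cf' l t Hl).
      + generalize (Hw l Hl). apply filter_imp. intros s Hs t.
        apply cont_at_mult; auto. eapply cderiv_cont. apply Dt, Hs.
    - intros l Hl.
      assert (CG : ccont (G' l)).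
      { intros t. apply (cont_at_precomp
          (fun p : R * R => (f' (w (fst p) (snd p)) * cis (1 * snd p))%C)
          (fun t : R => (l, t))).
        - apply (Cf' l t); lra.
        - intros P [d Hd]. exists d. intros s Hs. apply Hd.
          split; [apply ball_center|exact Hs]. }
      assert (Z : (RtoC l * Ci * CInt (G' l))%C = 0%C).
      { rewrite <- CInt_scal by auto.
        rewrite (CInt_ftc (fun t => f (w l t))).
        - unfold w. replace (1 * (2 * PI)) with (IZR 1 * (2 * PI)) by ring.
          rewrite cis_period, Rmult_0_r, cis_0. ring.
        - intros t. unfold G'.
          replace (RtoC l * Ci * (f' (w l t) * cis (1 * t)))%C with
            (f' (w l t) * (RtoC l * (RtoC 1 * Ci * cis (1 * t))))%C by ring.
          apply Dt, Hw0. lra.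
        - intros t. apply cont_at_mult; [apply cont_at_const|apply CG]. }
      destruct (CInt (G' l)) as [a b]. injection Z; simpl; intros Z1 Z2.
      apply C_ext; simpl; apply Rmult_eq_reg_l with l; lra. }
  rewrite (CInt_ext _ (fun t => (f (w 1 t) * k t)%C)), E,
    (CInt_ext _ (fun t => (f z * k t)%C)), CInt_scal; auto.
  - intros t. do 2 f_equal. unfold w. ring.
  - intros t. do 2 f_equal. unfold w. rewrite Rmult_1_l. ring.
Qed.

(** * Fourier coefficients *)

Lemma ccont_bounded (G : R -> C) : ccont G ->
  exists B, 0 <= B /\ forall t, 0 <= t <= 2 * PI -> Cmod (G t) <= B.
Proof.
  intros HG. pose proof two_PI_pos.
  destruct (continuity_ab_maj (fun t => Re (G t) * Re (G t) + Im (G t) * Im (G t))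
    0 (2 * PI)) as [m [Hm _]]; [lra| |].
  - intros t _. apply continuity_pt_filterlim.
    destruct (HG t) as [h1 h2].
    apply (continuous_plus (V := R_NormedModule) (fun t => Re (G t) * Re (G t))
      (fun t => Im (G t) * Im (G t)));
    apply (continuous_mult (K := R_AbsRing)); assumption.
  - exists (Cmod (G m)). split; [apply Cmod_ge_0|].
    intros t Ht. specialize (Hm t Ht).
    apply Rsqr_incr_0_var; [|apply Cmod_ge_0].
    rewrite !Rsqr_pow2, !Cmod2_alt. simpl. lra.
Qed.

(** [2 PI] times the Fourier coefficient, so that the rules below are free of
    constants. *)
Definition coef (G : R -> C) (k : Z) : C :=
  CInt (fun t => (G t * cis (- (IZR k * t)))%C).

Lemma ccont_cis_opp (k : R) : ccont (fun t => cis (- (k * t))).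
Proof.
  intros t. apply cont_at_ext with (fun t => cis (- k * t)).
  - intro; f_equal; ring.
  - apply ccont_cis.
Qed.

Lemma ccont_mult (G H : R -> C) : ccont G -> ccont H -> ccont (fun t => (G t * H t)%C).
Proof. intros h k t; apply cont_at_mult; auto. Qed.

Lemma coef_0 (G : R -> C) : coef G 0 = CInt G.
Proof.
  apply CInt_ext. intros t. rewrite Rmult_0_l, Ropp_0, cis_0. ring.
Qed.

Lemma coef_scal (c : C) (G : R -> C) (k : Z) : ccont G ->
  coef (fun t => (c * G t)%C) k = (c * coef G k)%C.
Proof.
  intros HG. unfold coef. rewrite <- CInt_scal.
  - apply CInt_ext. intro; ring.
  - apply ccont_mult; auto using ccont_cis_opp.
Qed.

Lemma coef_plus (G H : R -> C) (k : Z) : ccont G -> ccont H ->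
  coef (fun t => (G t + H t)%C) k = (coef G k + coef H k)%C.
Proof.
  intros HG HH. unfold coef. rewrite <- CInt_plus.
  - apply CInt_ext. intro; ring.
  - apply ccont_mult; auto using ccont_cis_opp.
  - apply ccont_mult; auto using ccont_cis_opp.
Qed.

Lemma coef_shift (G : R -> C) (j k : Z) :
  coef (fun t => (G t * cis (IZR j * t))%C) k = coef G (k - j).
Proof.
  apply CInt_ext. intros t. rewrite <- Cmult_assoc, <- cis_plus.
  do 2 f_equal. rewrite minus_IZR. ring.
Qed.

Lemma coef_conj (G : R -> C) (k : Z) : ccont G ->
  coef (fun t => Cconj (G t)) k = Cconj (coef G (- k)).
Proof.
  intros HG. unfold coef. rewrite <- CInt_conj.
  - apply CInt_ext. intros t. rewrite Cmult_conj, cis_conj.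
    do 2 f_equal. rewrite opp_IZR. ring.
  - apply ccont_mult; auto using ccont_cis_opp.
Qed.

Lemma coef_bound (G : R -> C) (B : R) : ccont G ->
  (forall t, 0 <= t <= 2 * PI -> Cmod (G t) <= B) ->
  forall k, Cmod (coef G k) <= 2 * PI * B.
Proof.
  intros HG HB k. apply CInt_bound.
  - apply ccont_mult; auto using ccont_cis_opp.
  - intros t Ht. rewrite Cmod_mult, Cmod_cis, Rmult_1_r. auto.
Qed.

(** * Expansion of the Cauchy kernel *)

(** The Cauchy kernel [cis t / (cis t - z)]. The frequency 1 is kept explicit
    so that the rules for [cis (k * t)] apply. *)
Definition kernel (z : C) (t : R) : C := (/ (1 - z * cis (- (1 * t))))%C.

Lemma kernel_den (z : C) (t : R) : Cmod z < 1 -> (1 - z * cis (- (1 * t)))%C <> 0%C.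
Proof.
  intros Hz E.
  assert (E' : (z * cis (- (1 * t)))%C = 1%C).
  { transitivity (1 - (1 - z * cis (- (1 * t))))%C; [ring|rewrite E; ring]. }
  apply (f_equal Cmod) in E'. rewrite Cmod_mult, Cmod_cis, Cmod_1 in E'. lra.
Qed.

Lemma ccont_kernel (z : C) : Cmod z < 1 -> ccont (kernel z).
Proof.
  intros Hz t. apply cont_at_inv; [now apply kernel_den|].
  apply cont_at_plus; [apply cont_at_const|].
  apply cont_at_ext with (fun t => (- z * cis (- (1 * t)))%C); [intro; ring|].
  apply cont_at_mult; [apply cont_at_const|apply ccont_cis_opp].
Qed.

Lemma kernel_step (z : C) (t : R) : Cmod z < 1 ->
  kernel z t = (1 + z * (kernel z t * cis (IZR (-1) * t)))%C.
Proof.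
  intros Hz. pose proof (kernel_den z t Hz).
  replace (IZR (-1) * t) with (- (1 * t)) by (simpl; ring).
  unfold kernel. field. exact H.
Qed.

Lemma kernel_cis (z : C) (t : R) : Cmod z < 1 -> (kernel z t * (cis t - z))%C = cis t.
Proof.
  intros Hz. pose proof (kernel_den z t Hz).
  assert (E : cis (- (1 * t)) = (/ cis t)%C).
  { rewrite Rmult_1_l.
    assert (E1 : (cis (- t) * cis t)%C = 1%C).
    { rewrite <- cis_plus, Rplus_opp_l. apply cis_0. }
    transitivity (cis (- t) * cis t * / cis t)%C.
    - field. apply cis_nonzero.
    - rewrite E1. field. apply cis_nonzero. }
  unfold kernel in *. rewrite E in *. pose proof (cis_nonzero t).
  field. split; auto.
  intro E2. apply H. transitivity ((cis t - z) / cis t)%C; [field; auto|].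
  rewrite E2. field; auto.
Qed.

(** Iterating [kernel z t = 1 + z cis (- t) kernel z t] gives the geometric
    series. A finite part with a remainder of geometric size is kept, so that
    finite sums of integrals suffice. *)
Lemma kernel_expansion (G : R -> C) (z : C) : ccont G -> Cmod z < 1 ->
  exists B, 0 <= B /\ forall N,
    Cmod (CInt (fun t => (G t * kernel z t)%C) - CInt G) <=
    sum_f_R0 (fun n => Cmod z ^ S n * Cmod (coef G (Z.of_nat (S n)))) N
    + Cmod z ^ S (S N) * B.
Proof.
  intros HG Hz.
  set (H := fun t => (G t * kernel z t)%C).
  assert (HH : ccont H) by (apply ccont_mult; auto using ccont_kernel).
  destruct (ccont_bounded H HH) as [B [B0 HB]].
  pose proof two_PI_pos.
  assert (St : forall k, coef H k = (coef G k + z * coef H (k + 1))%C).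
  { intros k. replace (k + 1)%Z with (k - (-1))%Z by ring.
    rewrite <- coef_shift, <- coef_scal, <- coef_plus; auto.
    - apply CInt_ext. intros t. f_equal. unfold H.
      rewrite (kernel_step z t Hz) at 1. ring.
    - apply ccont_mult; [intro; apply cont_at_const|].
      apply ccont_mult; auto using ccont_cis.
    - apply ccont_mult; auto using ccont_cis. }
  exists (2 * PI * B). split; [nra|].
  assert (P : forall N, Cmod (coef H 0 - coef G 0)%C <=
    sum_f_R0 (fun n => Cmod z ^ S n * Cmod (coef G (Z.of_nat (S n)))) N
    + Cmod z ^ S (S N) * Cmod (coef H (Z.of_nat (S (S N))))).
  { assert (Q : forall N, Cmod z ^ S N * Cmod (coef H (Z.of_nat (S N))) <=
       Cmod z ^ S N * Cmod (coef G (Z.of_nat (S N))) +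
       Cmod z ^ S (S N) * Cmod (coef H (Z.of_nat (S (S N))))).
    { intros N. rewrite (St (Z.of_nat (S N))).
      replace (Z.of_nat (S N) + 1)%Z with (Z.of_nat (S (S N))) by lia.
      replace (Cmod z ^ S (S N)) with (Cmod z ^ S N * Cmod z) by (simpl; ring).
      rewrite Rmult_assoc, <- Rmult_plus_distr_l.
      apply Rmult_le_compat_l; [apply pow_le, Cmod_ge_0|].
      eapply Rle_trans; [apply Cmod_triangle|]. rewrite Cmod_mult. lra. }
    induction N as [|N IH].
    - eapply Rle_trans; [|apply (Q 0%nat)]. right.
      rewrite (St 0%Z). simpl Z.of_nat. rewrite Z.add_0_l.
      replace (coef G 0 + z * coef H 1 - coef G 0)%C with (z * coef H 1)%C by ring.
      rewrite Cmod_mult. simpl. ring.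
    - rewrite tech5. eapply Rle_trans; [apply IH|].
      specialize (Q (S N)). lra. }
  rewrite !coef_0 in P. intros N. eapply Rle_trans; [apply (P N)|].
  apply Rplus_le_compat_l. apply Rmult_le_compat_l; [apply pow_le, Cmod_ge_0|].
  now apply coef_bound.
Qed.

Lemma le_of_le_geometric (a b q B : R) : 0 <= q < 1 -> 0 <= B ->
  (forall N, a <= b + q ^ S (S N) * B) -> a <= b.
Proof.
  intros Hq HB H. apply Rnot_lt_le. intro Hab.
  assert (E : 0 < (a - b) / (B + 1)) by (apply Rdiv_lt_0_compat; lra).
  destruct (pow_lt_1_zero q ltac:(rewrite Rabs_pos_eq; lra) _ E) as [N HN].
  specialize (HN (S (S N)) ltac:(lia)). specialize (H N).
  rewrite Rabs_pos_eq in HN by (apply pow_le; lra).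
  apply (Rmult_lt_compat_r (B + 1)) in HN; [|lra].
  unfold Rdiv in HN. rewrite Rmult_assoc, Rinv_l in HN by lra.
  assert (0 <= q ^ S (S N)) by (apply pow_le; lra). nra.
Qed.

(** All terms of the geometric expansion after the first integrate to 0. *)
Lemma CInt_kernel (z : C) : Cmod z < 1 -> CInt (kernel z) = RtoC (2 * PI).
Proof.
  intros Hz.
  destruct (kernel_expansion (fun _ => 1%C) z) as [B [B0 HB]]; auto.
  { intro; apply cont_at_const. }
  rewrite CInt_const, Cmult_1_r in HB.
  rewrite (CInt_ext _ (kernel z)) in HB by (intro; ring).
  assert (E : Cmod (CInt (kernel z) - RtoC (2 * PI))%C <= 0).
  { apply le_of_le_geometric with (Cmod z) B; auto.
    { split; auto. apply Cmod_ge_0. }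
    intros N. eapply Rle_trans; [apply (HB N)|]. apply Rplus_le_compat_r.
    right. apply sum_eq_R0. intros n _.
    replace (coef (fun _ => 1%C) (Z.of_nat (S n))) with (RtoC 0).
    - rewrite Cmod_0. ring.
    - symmetry. unfold coef. rewrite (CInt_ext _ (fun t => cis (IZR (- Z.of_nat (S n)) * t))).
      + rewrite CInt_cis. destruct Z.eq_dec; [lia|auto].
      + intros t. rewrite Cmult_1_l. f_equal. rewrite opp_IZR. ring. }
  assert (E0 : (CInt (kernel z) - RtoC (2 * PI))%C = 0%C).
  { apply Cmod_eq_0. apply Rle_antisym; auto. apply Cmod_ge_0. }
  transitivity (CInt (kernel z) - RtoC (2 * PI) + RtoC (2 * PI))%C; [ring|].
  rewrite E0. ring.
Qed.

Lemma holomorphic_scale (rho : R) (f f' : C -> C) : 0 < rho ->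
  holomorphic (disk 1) f f' ->
  holomorphic (disk (/ rho)) (fun z => f (RtoC rho * z)%C)
    (fun z => (RtoC rho * f' (RtoC rho * z))%C).
Proof.
  intros Hrho Hf z Hz.
  assert (Hz' : disk 1 (RtoC rho * z)%C).
  { unfold disk in *. rewrite Cmod_mult, Cmod_R, Rabs_pos_eq by lra.
    apply (Rmult_lt_compat_l rho) in Hz; auto. rewrite Rinv_r in Hz; lra. }
  destruct (Hf _ Hz') as [[h1 h2] hc].
  assert (A : forall (a b : R) (x y : R),
     differentiable_pt_lim (fun x y => a * x + b * y) x y a b).
  { intros a b x y eps. apply locally_2d_forall. intros s t.
    replace (_ - _) with 0 by ring. rewrite Rabs_R0.
    apply Rmult_le_pos; [apply Rlt_le, cond_pos|].
    eapply Rle_trans; [apply Rabs_pos|apply Rmax_l]. }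
  assert (S : forall (p : R -> R -> R) (q : C -> R) l m, 
     (forall x y, p x y = q (f (x, y))) ->
     differentiable_pt_lim p (Re (RtoC rho * z)%C) (Im (RtoC rho * z)%C) l m ->
     differentiable_pt_lim (fun x y => q (f (RtoC rho * (x, y))%C)) (Re z) (Im z)
       (rho * l) (rho * m)).
  { intros p q l m Hp H.
    apply differentiable_pt_lim_ext with
      (fun x y => p (rho * x + 0 * y) (0 * x + rho * y)).
    { apply locally_2d_forall. intros x y. rewrite Hp. do 2 f_equal.
      apply C_ext; simpl; ring. }
    replace (rho * l) with (l * rho + m * 0) by ring.
    replace (rho * m) with (l * 0 + m * rho) by ring.
    apply (differentiable_pt_lim_comp p (fun x y => rho * x + 0 * y)
       (fun x y => 0 * x + rho * y)); auto.
    replace (rho * Re z + 0 * Im z) with (Re (RtoC rho * z)%C)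
      by (simpl; unfold Re, Im; ring).
    replace (0 * Re z + rho * Im z) with (Im (RtoC rho * z)%C)
      by (simpl; unfold Re, Im; ring).
    exact H. }
  split; [split|].
  - pose proof (S _ Re _ _ (fun _ _ => eq_refl) h1) as E.
    match_partials E.
  - pose proof (S _ Im _ _ (fun _ _ => eq_refl) h2) as E.
    match_partials E.
  - apply cont_at_mult; [apply cont_at_const|].
    apply (cont_at_comp f' (fun z => (RtoC rho * z)%C)); auto.
    apply cont_at_mult; [apply cont_at_const|].
    split; [apply (continuous_fst (U := R_UniformSpace) (V := R_UniformSpace))|
            apply (continuous_snd (U := R_UniformSpace) (V := R_UniformSpace))].
Qed.

Definition circ (rho t : R) : C := (RtoC rho * cis (1 * t))%C.

Lemma cderiv_circ (rho t : R) : cderiv (circ rho) t (Ci * circ rho t)%C.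
Proof.
  eapply cderiv_eq; [|exact (cderiv_mult _ _ _ _ _ (cderiv_const (RtoC rho) t)
    (cderiv_cis 1 t))].
  unfold circ. cbv beta. ring.
Qed.

Lemma circ_in_disk (rho t : R) : 0 < rho < 1 -> disk 1 (circ rho t).
Proof.
  intros H. unfold disk, circ. rewrite Cmod_mult, Cmod_cis, Cmod_R, Rabs_pos_eq; lra.
Qed.

Lemma holomorphic_circ_cont (f f' : C -> C) (rho : R) : 0 < rho < 1 ->
  holomorphic (disk 1) f f' -> ccont (fun t => f (circ rho t)).
Proof.
  intros Hr Hf t. eapply cderiv_cont. apply (holomorphic_chain (disk 1) f f'); auto.
  - now apply circ_in_disk.
  - apply cderiv_circ.
Qed.

Lemma cauchy_formula (f f' : C -> C) (rho : R) (z : C) : 0 < rho < 1 ->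
  holomorphic (disk 1) f f' -> Cmod z < 1 ->
  CInt (fun t => (f (circ rho t) * kernel z t)%C) =
  (RtoC (2 * PI) * f (RtoC rho * z))%C.
Proof.
  intros Hr Hf Hz.
  assert (Hf2 := holomorphic_scale rho f f' (proj1 Hr) Hf).
  rewrite <- (CInt_kernel z), Cmult_comm by auto.
  rewrite <- (cauchy_kernel (/ rho) _ _ z (kernel z) ) with (2 := Hf2); auto.
  - apply CInt_ext. intro. unfold circ. now rewrite Rmult_1_l.
  - rewrite <- Rinv_1. apply Rinv_lt_contravar; lra.
  - now apply ccont_kernel.
  - intro; now apply kernel_cis.
Qed.

Lemma mean_value (f f' : C -> C) (rho : R) : 0 < rho < 1 ->
  holomorphic (disk 1) f f' ->
  CInt (fun t => f (circ rho t)) = (RtoC (2 * PI) * f 0)%C.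
Proof.
  intros Hr Hf.
  replace (RtoC 0) with (RtoC rho * 0)%C at 1 by ring.
  rewrite <- (cauchy_formula f f' rho 0); auto.
  - apply CInt_ext. intros t. unfold kernel.
    replace (1 - 0 * cis (- (1 * t)))%C with (RtoC 1) by ring.
    field.
  - rewrite Cmod_0; lra.
Qed.

(** * Sharp bound for a pair of opposite coefficients *)

Lemma continuous_abs_cos (t : R) : continuous (fun t => Rabs (cos t)) t.
Proof.
  apply (continuous_comp cos Rabs).
  - apply continuity_pt_filterlim, continuity_cos.
  - apply continuity_pt_filterlim, Rcontinuity_abs.
Qed.

Lemma continuous_abs_cos_lin (u v t : R) :
  continuous (fun t => Rabs (cos (u * t + v))) t.
Proof.
  apply (continuous_comp (fun t => u * t + v) (fun t => Rabs (cos t)));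
    [|apply continuous_abs_cos].
  apply (ex_derive_continuous (K := R_AbsRing) (V := R_NormedModule)).
  auto_derive; auto.
Qed.

(** [|cos|] has period [PI], so the window may be moved to
    [[- PI / 2, PI / 2]], where the cosine is nonnegative. *)
Lemma RInt_abs_cos_half (a : R) : RInt (fun t => Rabs (cos t)) a (a + PI) = 2.
Proof.
  pose proof continuous_abs_cos as Cc.
  assert (Ex : forall a b, ex_RInt (fun t => Rabs (cos t)) a b)
    by (intros; apply cont_RInt; auto).
  pose proof PI_RGT_0.
  assert (B : RInt (fun t => Rabs (cos t)) (- (PI / 2)) (PI / 2) = 2).
  { rewrite (RInt_ext _ cos).
    - transitivity (minus (sin (PI / 2)) (sin (- (PI / 2)))).
      2:{ rewrite sin_neg, sin_PI2. unfold minus, plus, opp; simpl; ring. }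
      apply is_RInt_unique.
      apply (is_RInt_derive (V := R_CompleteNormedModule) sin cos).
      + intros t _. apply is_derive_Reals, derivable_pt_lim_sin.
      + intros t _. apply continuity_pt_filterlim, continuity_cos.
    - rewrite Rmin_left, Rmax_right by lra. intros t Ht.
      apply Rabs_pos_eq, cos_ge_0; lra. }
  assert (P : RInt (fun t => Rabs (cos t)) (PI / 2) (a + PI) =
              RInt (fun t => Rabs (cos t)) (- (PI / 2)) a).
  { replace (PI / 2) with (1 * (- (PI / 2)) + PI) at 1 by field.
    replace (a + PI) with (1 * a + PI) by ring.
    rewrite <- (RInt_comp_lin (V := R_CompleteNormedModule)) by auto.
    apply RInt_ext. intros t _. rewrite neg_cos, Rabs_Ropp, (Rmult_1_l t).
    apply Rmult_1_l. }
  rewrite <- (RInt_Chasles (V := R_CompleteNormedModule) _ a (PI / 2)) by auto.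
  rewrite <- (RInt_Chasles (V := R_CompleteNormedModule) _ a (- (PI / 2)) (PI / 2)) by auto.
  rewrite P, B.
  rewrite <- (opp_RInt_swap (V := R_CompleteNormedModule)) by auto.
  unfold plus, opp; simpl; ring.
Qed.

Lemma RInt_abs_cos (N : nat) (c : R) : (1 <= N)%nat ->
  RInt (fun t => Rabs (cos (INR N * t + c))) 0 (2 * PI) = 4.
Proof.
  intros HN.
  pose proof continuous_abs_cos as Cc.
  assert (Ex : forall a b, ex_RInt (fun t => Rabs (cos t)) a b)
    by (intros; apply cont_RInt; auto).
  assert (P : forall n, RInt (fun t => Rabs (cos t)) c (c + INR n * PI) = 2 * INR n).
  { induction n as [|n IH].
    - simpl INR. rewrite Rmult_0_l, Rplus_0_r.
      rewrite (RInt_point (V := R_CompleteNormedModule)).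
      unfold zero; simpl; ring.
    - rewrite <- (RInt_Chasles (V := R_CompleteNormedModule) _ c (c + INR n * PI)) by auto.
      rewrite IH, S_INR. replace (c + (INR n + 1) * PI) with ((c + INR n * PI) + PI) by ring.
      rewrite RInt_abs_cos_half. unfold plus; simpl; ring. }
  assert (HN' : 0 < INR N) by (apply lt_0_INR; lia).
  pose proof (RInt_comp_lin (V := R_CompleteNormedModule) (fun t => Rabs (cos t))
    (INR N) c 0 (2 * PI) (Ex _ _)) as E.
  replace (INR N * 0 + c) with c in E by ring.
  replace (INR N * (2 * PI) + c) with (c + INR (2 * N) * PI) in E
    by (rewrite mult_INR; simpl; ring).
  rewrite P in E. rewrite (RInt_scal (V := R_CompleteNormedModule)) in E.
  - unfold scal in E; simpl in E; unfold mult in E; simpl in E.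
    apply Rmult_eq_reg_l with (INR N); [|lra]. rewrite E.
    rewrite Nat.add_0_r, plus_INR. ring.
  - apply cont_RInt, continuous_abs_cos_lin.
Qed.

Lemma polar (z : C) : exists a, z = (RtoC (Cmod z) * cis a)%C.
Proof.
  destruct (Req_dec (Cmod z) 0) as [E|E].
  { exists 0. rewrite E. apply Cmod_eq_0 in E. rewrite E. ring. }
  pose proof (Cmod_ge_0 z).
  set (x := Re z / Cmod z). set (y := Im z / Cmod z).
  assert (Exy : x² + y² = 1).
  { pose proof (Cmod2_alt z). unfold x, y, Rsqr. field_simplify; auto.
    rewrite <- H0. field; auto. }
  assert (Hx : -1 <= x <= 1) by (split; unfold Rsqr in Exy; nra).
  assert (Hs : sin (acos x) = Rabs y).
  { rewrite sin_acos by auto. rewrite <- sqrt_Rsqr_abs. f_equal. lra. }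
  destruct (Rle_dec 0 y) as [Hy|Hy].
  - exists (acos x). rewrite Rabs_pos_eq in Hs by auto.
    apply C_ext; simpl; rewrite ?Hs, ?cos_acos by auto; unfold x, y; field; auto.
  - exists (- acos x). rewrite Rabs_left in Hs by lra.
    apply C_ext; simpl; rewrite ?sin_neg, ?cos_neg, ?Hs, ?cos_acos by auto;
      unfold x, y; field; auto.
Qed.

Lemma cis_sum (a b : R) :
  (cis a + cis b)%C = (RtoC (2 * cos ((a - b) / 2)) * cis ((a + b) / 2))%C.
Proof.
  apply C_ext; simpl; [rewrite form1|rewrite form3]; ring.
Qed.

Lemma dot_cis_shift (z w : C) (t : R) : dot z (w * cis (- t))%C = dot (z * cis t)%C w.
Proof.
  unfold dot; simpl; rewrite cos_neg, sin_neg. unfold Re, Im. ring.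
Qed.

Lemma dot_plus_l (z1 z2 w : C) : dot (z1 + z2)%C w = dot z1 w + dot z2 w.
Proof. unfold dot; simpl; unfold Re, Im; ring. Qed.

Lemma dot_polar (z : C) (a : R) : z = (RtoC (Cmod z) * cis a)%C -> Cmod z = dot (cis a) z.
Proof.
  intros E. rewrite E at 2. unfold dot; simpl. pose proof (sin2_cos2 a) as H.
  unfold Rsqr in H. transitivity (Cmod z * (sin a * sin a + cos a * cos a));
    [rewrite H|]; ring.
Qed.

(** Rotate both coefficients to the positive axis by unit numbers [cis a] and
    [cis b]. The sum of their moduli becomes the integral of the inner product
    of [G] with [cis (a + N t) + cis (b - N t)], a vector of length
    [2 |cos (N t + (a - b) / 2)|]. The integral of this length is 8. *)
Lemma coef_pair_bound (G : R -> C) (M : R) (N : nat) : ccont G -> (1 <= N)%nat ->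
  (forall t, 0 <= t <= 2 * PI -> Cmod (G t) <= M) ->
  Cmod (coef G (Z.of_nat N)) + Cmod (coef G (- Z.of_nat N)) <= 8 * M.
Proof.
  intros HG HN HM. pose proof two_PI_pos.
  destruct (polar (coef G (Z.of_nat N))) as [a Ha].
  destruct (polar (coef G (- Z.of_nat N))) as [b Hb].
  apply dot_polar in Ha, Hb. rewrite Ha, Hb.
  assert (C1 : forall k, ccont (fun t => (G t * cis (- (k * t)))%C))
    by (intro; apply ccont_mult; auto using ccont_cis_opp).
  unfold coef. rewrite !CInt_dot by auto.
  rewrite <- (RInt_plus (V := R_CompleteNormedModule))
    by (apply cont_RInt, cont_dot; auto).
  replace (8 * M) with (2 * M * 4) by ring.
  rewrite <- (RInt_abs_cos N ((a - b) / 2) HN).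
  rewrite <- (RInt_scal (V := R_CompleteNormedModule) _ 0 (2 * PI) (2 * M))
    by apply cont_RInt, continuous_abs_cos_lin.
  apply RInt_le; [lra| | |].
  - apply cont_RInt. intro t. exact (continuous_plus (V := R_NormedModule) _ _ t
      (cont_dot _ _ (C1 _) t) (cont_dot _ _ (C1 _) t)).
  - apply cont_RInt. intro t. apply (continuous_scal_r (V := R_NormedModule)).
    apply continuous_abs_cos_lin.
  - intros t Ht. unfold plus; simpl. rewrite !dot_cis_shift, <- dot_plus_l.
    rewrite <- !cis_plus, cis_sum.
    eapply Rle_trans; [apply dot_le|].
    rewrite Cmod_mult, Cmod_cis, Cmod_R, Rmult_1_r, Rabs_mult, (Rabs_pos_eq 2) by lra.
    replace ((a + IZR (Z.of_nat N) * t - (b + IZR (- Z.of_nat N) * t)) / 2)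
      with (INR N * t + (a - b) / 2)
      by (rewrite opp_IZR, INR_IZR_INZ; field).
    unfold scal; simpl; unfold mult; simpl.
    pose proof (Rabs_pos (cos (INR N * t + (a - b) / 2))).
    assert (Cmod (G t) <= M) by (apply HM; lra). nra.
Qed.

(** * Bessel's inequality *)

Fixpoint trig_sum (c : Z -> C) (l : list Z) (t : R) : C :=
  match l with
  | nil => 0
  | k :: l' => c k * cis (IZR k * t) + trig_sum c l' t
  end.

Lemma ccont_trig_sum (c : Z -> C) (l : list Z) : ccont (trig_sum c l).
Proof.
  induction l as [|k l IH]; intro t; simpl.
  - apply cont_at_const.
  - apply cont_at_plus; auto.
    apply cont_at_mult; [apply cont_at_const|apply ccont_cis].
Qed.

Lemma coef_trig_sum_notin (c : Z -> C) (l : list Z) (k : Z) :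
  ~ In k l -> coef (trig_sum c l) k = 0%C.
Proof.
  induction l as [|j l IH]; simpl; intros H.
  - unfold coef. rewrite (CInt_ext _ (fun _ => RtoC 0)) by (intro; simpl; ring).
    rewrite CInt_const. ring.
  - rewrite (coef_plus (fun t => c j * cis (IZR j * t))%C (trig_sum c l)).
    + rewrite IH by tauto. rewrite (coef_scal (c j) (fun t => cis (IZR j * t))).
      2:{ apply ccont_cis. }
      unfold coef. rewrite (CInt_ext _ (fun t => cis (IZR (j - k) * t))).
      * rewrite CInt_cis. destruct Z.eq_dec; [exfalso; apply H; left; lia|ring].
      * intros t. rewrite <- cis_plus, minus_IZR. f_equal. ring.
    + apply ccont_mult; [intro; apply cont_at_const|apply ccont_cis].
    + apply ccont_trig_sum.
Qed.

Lemma coef_trig_sum_in (c : Z -> C) (l : list Z) (k : Z) :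
  NoDup l -> In k l -> coef (trig_sum c l) k = (RtoC (2 * PI) * c k)%C.
Proof.
  induction 1 as [|j l Hj Hl IH]; simpl; intros H; [tauto|].
  rewrite (coef_plus (fun t => c j * cis (IZR j * t))%C (trig_sum c l)).
  - rewrite (coef_scal (c j) (fun t => cis (IZR j * t))) by apply ccont_cis.
    unfold coef at 1. rewrite (CInt_ext _ (fun t => cis (IZR (j - k) * t))).
    + rewrite CInt_cis. destruct Z.eq_dec as [E|E].
      * replace j with k in * by lia. rewrite coef_trig_sum_notin by auto. ring.
      * rewrite IH; [ring|]. destruct H; [exfalso; lia|auto].
    + intros t. rewrite <- cis_plus, minus_IZR. f_equal. ring.
  - apply ccont_mult; [intro; apply cont_at_const|apply ccont_cis].
  - apply ccont_trig_sum.
Qed.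

Fixpoint list_sum (h : Z -> R) (l : list Z) : R :=
  match l with
  | nil => 0
  | k :: l' => h k + list_sum h l'
  end.

Lemma list_sum_ext (h1 h2 : Z -> R) (l : list Z) :
  (forall k, In k l -> h1 k = h2 k) -> list_sum h1 l = list_sum h2 l.
Proof.
  induction l as [|k l IH]; simpl; auto. intros H. rewrite H, IH; auto.
Qed.

Lemma list_sum_scal (a : R) (h : Z -> R) (l : list Z) :
  list_sum (fun k => a * h k) l = a * list_sum h l.
Proof. induction l as [|k l IH]; simpl; [ring|rewrite IH; ring]. Qed.

Lemma cont_dot_pointwise (G H : R -> C) : ccont G -> ccont H ->
  forall t : R, continuous (fun s => dot (G s) (H s)) t.
Proof.
  intros HG HH t. destruct (HG t) as [h1 h2], (HH t) as [k1 k2].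
  apply (continuous_plus (V := R_NormedModule)
    (fun s => Re (G s) * Re (H s)) (fun s => Im (G s) * Im (H s)));
  apply (continuous_mult (K := R_AbsRing)); assumption.
Qed.

Lemma RInt_dot_trig_sum (c : Z -> C) (H : R -> C) (l : list Z) : ccont H ->
  RInt (fun t => dot (trig_sum c l t) (H t)) 0 (2 * PI) =
  list_sum (fun k => dot (c k) (coef H k)) l.
Proof.
  intros HH. induction l as [|k l IH]; simpl.
  - rewrite (RInt_ext _ (fun _ => 0)).
    + rewrite (RInt_const (V := R_CompleteNormedModule)). apply Rmult_0_r.
    + intros t _. unfold dot; simpl. ring.
  - rewrite (RInt_ext _ (fun t => plus (dot (c k) (H t * cis (- (IZR k * t)))%C)
       (dot (trig_sum c l t) (H t)))).
    + rewrite (RInt_plus (V := R_CompleteNormedModule)), IH.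
      * unfold coef. rewrite CInt_dot; auto.
        apply ccont_mult; auto using ccont_cis_opp.
      * apply cont_RInt, cont_dot, ccont_mult; auto using ccont_cis_opp.
      * apply cont_RInt, cont_dot_pointwise; auto using ccont_trig_sum.
    + intros t _. rewrite dot_cis_shift. apply dot_plus_l.
Qed.

(** For the trigonometric sum [T] with the normalised coefficients of [G], the
    integrals of [<T, G>] and of [|T|^2] are the same multiple of the sum of
    squares; integrate [2 <T, G> - |T|^2 <= |G|^2]. *)
Lemma bessel (G : R -> C) (M : R) (l : list Z) : ccont G -> NoDup l ->
  (forall t, 0 <= t <= 2 * PI -> Cmod (G t) <= M) ->
  list_sum (fun k => Cmod (coef G k) ^ 2) l <= (2 * PI * M) ^ 2.
Proof.
  intros HG Hl HM. pose proof two_PI_pos.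
  set (c := fun k => (RtoC (/ (2 * PI)) * coef G k)%C).
  set (S := list_sum (fun k => Cmod (coef G k) ^ 2) l).
  assert (E1 : RInt (fun t => dot (trig_sum c l t) (G t)) 0 (2 * PI) = / (2 * PI) * S).
  { rewrite RInt_dot_trig_sum by auto. unfold S. rewrite <- list_sum_scal.
    apply list_sum_ext. intros k _. rewrite <- dot_self. unfold c, dot; simpl.
    unfold Re, Im. ring. }
  assert (E2 : RInt (fun t => dot (trig_sum c l t) (trig_sum c l t)) 0 (2 * PI) = / (2 * PI) * S).
  { rewrite RInt_dot_trig_sum by apply ccont_trig_sum. unfold S. rewrite <- list_sum_scal.
    apply list_sum_ext. intros k Hk. rewrite coef_trig_sum_in by auto.
    rewrite <- dot_self. unfold c, dot; simpl. unfold Re, Im. field. lra. }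
  assert (X1 : ex_RInt (fun t => dot (trig_sum c l t) (G t)) 0 (2 * PI))
    by (apply cont_RInt, cont_dot_pointwise; auto using ccont_trig_sum).
  assert (X2 : ex_RInt (fun t => dot (trig_sum c l t) (trig_sum c l t)) 0 (2 * PI))
    by (apply cont_RInt, cont_dot_pointwise; auto using ccont_trig_sum).
  assert (L : 2 * (/ (2 * PI) * S) - / (2 * PI) * S <= 2 * PI * M ^ 2).
  { rewrite <- E2 at 2. rewrite <- E1.
    assert (E3 : RInt (fun t => minus (scal 2 (dot (trig_sum c l t) (G t)))
       (dot (trig_sum c l t) (trig_sum c l t))) 0 (2 * PI) <= RInt (fun _ => M ^ 2) 0 (2 * PI)).
    { apply RInt_le; [lra| | |].
      - apply (ex_RInt_minus (V := R_CompleteNormedModule)); auto.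
        now apply (ex_RInt_scal (V := R_CompleteNormedModule)).
      - apply cont_RInt. intro; apply continuous_const.
      - intros t Ht. specialize (HM t ltac:(lra)).
        assert (D : dot (trig_sum c l t - G t)%C (trig_sum c l t - G t)%C =
          dot (trig_sum c l t) (trig_sum c l t) - 2 * dot (trig_sum c l t) (G t) + dot (G t) (G t)).
        { unfold dot; simpl; unfold Re, Im; ring. }
        rewrite (dot_self (_ - _)%C), (dot_self (G t)) in D.
        pose proof (pow2_ge_0 (Cmod (trig_sum c l t - G t)%C)).
        pose proof (Cmod_ge_0 (G t)).
        change (2 * dot (trig_sum c l t) (G t) - dot (trig_sum c l t) (trig_sum c l t) <= M ^ 2).
        nra. }
    rewrite (RInt_minus (V := R_CompleteNormedModule)) in E3; auto.
    2:{ now apply (ex_RInt_scal (V := R_CompleteNormedModule)). }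
    rewrite (RInt_scal (V := R_CompleteNormedModule)) in E3 by auto.
    rewrite (RInt_const (V := R_CompleteNormedModule)) in E3.
    unfold minus, plus, opp, scal in E3; simpl in E3. unfold mult in E3; simpl in E3.
    simpl. lra. }
  apply (Rmult_le_compat_l (2 * PI)) in L; [|lra].
  replace (2 * PI * (2 * (/ (2 * PI) * S) - / (2 * PI) * S)) with S in L by (field; lra).
  fold S. simpl in *. lra.
Qed.

(** * Coefficients of a harmonic function and of its derivatives *)

Lemma differentiable_Rmult (x y : R) :
  differentiable_pt_lim (fun a b => a * b) x y y x.
Proof.
  intros eps. exists eps. intros u v Hu Hv.
  replace (u * v - x * y - (y * (u - x) + x * (v - y))) with ((u - x) * (v - y)) by ring.
  rewrite Rabs_mult. apply Rmult_le_compat; try apply Rabs_pos.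
  - now apply Rlt_le.
  - apply Rmax_r.
Qed.

Lemma differentiable_mult (p q : R -> R -> R) (x y px py qx qy : R) :
  differentiable_pt_lim p x y px py -> differentiable_pt_lim q x y qx qy ->
  differentiable_pt_lim (fun s t => p s t * q s t) x y
    (q x y * px + p x y * qx) (q x y * py + p x y * qy).
Proof.
  intros Hp Hq.
  apply (differentiable_pt_lim_comp (fun s t => s * t) p q); auto.
  apply differentiable_Rmult.
Qed.

Lemma wirtinger_cont (f : C -> C) (z a b : C) : wirtinger f z a b -> cont_at f z.
Proof.
  destruct z as [x y]. intros [h1 h2].
  apply cont_at_ext with (fun p : C => f (fst p, snd p)); [now intros []|].
  split.
  - apply (proj1 (continuity_2d_pt_filterlim (fun x y => Re (f (x, y))) x y)).
    apply differentiable_continuity_pt. eexists; eexists; exact h1.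
  - apply (proj1 (continuity_2d_pt_filterlim (fun x y => Im (f (x, y))) x y)).
    apply differentiable_continuity_pt. eexists; eexists; exact h2.
Qed.

Lemma cont_at_id (z : C) : cont_at (fun w : C => w) z.
Proof.
  split; [apply (continuous_fst (U := R_UniformSpace) (V := R_UniformSpace))|
          apply (continuous_snd (U := R_UniformSpace) (V := R_UniformSpace))].
Qed.

(** Makes the mean value property available for [z^m f]. *)
Lemma holomorphic_mul_id (D : C -> Prop) (f f' : C -> C) :
  holomorphic D f f' ->
  holomorphic D (fun z => z * f z)%C (fun z => f z + z * f' z)%C.
Proof.
  intros Hf z Hz. destruct (Hf z Hz) as [Hw Hc].
  pose proof (wirtinger_cont f z _ _ Hw) as Cf. destruct Hw as [h1 h2].
  assert (X : differentiable_pt_lim (fun x _ => x) (Re z) (Im z) 1 0).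
  { apply (differentiable_pt_lim_proj1_0 (fun x => x)).
    apply derivable_pt_lim_id. }
  assert (Y : differentiable_pt_lim (fun _ y => y) (Re z) (Im z) 0 1).
  { intros eps. apply locally_2d_forall. intros u v.
    replace (_ - _) with 0 by ring. rewrite Rabs_R0.
    apply Rmult_le_pos; [apply Rlt_le, cond_pos|].
    eapply Rle_trans; [apply Rabs_pos|apply Rmax_l]. }
  split; [split|].
  - pose proof (differentiable_lin 1 (-1) _ _ _ _ _ _ _ _
       (differentiable_mult _ _ _ _ _ _ _ _ X h1)
       (differentiable_mult _ _ _ _ _ _ _ _ Y h2)) as E.
    eapply differentiable_pt_lim_ext in E.
    2:{ apply locally_2d_forall. intros x y.
        instantiate (1 := fun x y => Re ((x, y) * f (x, y))%C). simpl. unfold Re, Im. ring. }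
    destruct z as [x y].
    match_partials E.
  - pose proof (differentiable_lin 1 1 _ _ _ _ _ _ _ _
       (differentiable_mult _ _ _ _ _ _ _ _ X h2)
       (differentiable_mult _ _ _ _ _ _ _ _ Y h1)) as E.
    eapply differentiable_pt_lim_ext in E.
    2:{ apply locally_2d_forall. intros x y.
        instantiate (1 := fun x y => Im ((x, y) * f (x, y))%C). simpl. unfold Re, Im. ring. }
    destruct z as [x y].
    match_partials E.
  - apply cont_at_plus; auto. apply cont_at_mult; auto. apply cont_at_id.
Qed.

(** Up to a power of [rho], the coefficient of frequency [- m] is the mean over
    the circle of [z^m f], a holomorphic function vanishing at 0. *)
Lemma coef_holomorphic_neg (rho : R) (m : nat) (f f' : C -> C) : 0 < rho < 1 ->
  holomorphic (disk 1) f f' ->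
  coef (fun t => f (circ rho t)) (- Z.of_nat (S m)) = 0%C.
Proof.
  intros Hr. revert f f'.
  assert (St : forall f f' k, holomorphic (disk 1) f f' ->
    coef (fun t => circ rho t * f (circ rho t))%C k =
    (RtoC rho * coef (fun t => f (circ rho t)) (k - 1))%C).
  { intros f f' k Hf.
    pose proof (holomorphic_circ_cont f f' rho Hr Hf) as Cf.
    rewrite <- coef_shift, <- coef_scal.
    - apply CInt_ext. intros t. unfold circ. simpl. ring.
    - apply ccont_mult; auto using ccont_cis. }
  assert (R0 : forall w, (RtoC rho * w)%C = 0%C -> w = 0%C).
  { intros w E. transitivity (/ RtoC rho * (RtoC rho * w))%C; [field|rewrite E; ring].
    intro E'; injection E'; lra. }
  induction m as [|m IH]; intros f f' Hf; apply R0.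
  - pose proof (mean_value _ _ rho Hr (holomorphic_mul_id _ _ _ Hf)) as E.
    cbv beta in E. rewrite <- coef_0, (St f f' 0%Z Hf) in E.
    simpl in *. rewrite E. ring.
  - rewrite <- (IH _ _ (holomorphic_mul_id _ _ _ Hf)), (St f f') by auto.
    do 2 f_equal. lia.
Qed.

(** Integration by parts along the circle [z = circ rho t], where the
    derivative of [g z] in [t] is [i (z f - conj (z e))]. The factor [z] shifts
    frequencies by one and conjugation reverses them. *)
Lemma coef_derivative (rho : R) (g f e : C -> C) (k : Z) : 0 < rho < 1 ->
  harmonic_pair (disk 1) g f e ->
  (RtoC (IZR k) * coef (fun t => g (circ rho t)) k)%C =
  (RtoC rho * (coef (fun t => f (circ rho t)) (k - 1)
    - Cconj (coef (fun t => e (circ rho t)) (- k - 1))))%C.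
Proof.
  intros Hr [Hg [[f' Hf] [e' He]]].
  pose proof (holomorphic_circ_cont f f' rho Hr Hf) as Cf.
  pose proof (holomorphic_circ_cont e e' rho Hr He) as Ce.
  set (Fe := fun t => f (circ rho t)) in *. set (Ee := fun t => e (circ rho t)) in *.
  set (G := fun t => g (circ rho t)).
  assert (DG : forall t, cderiv G t (Fe t * (Ci * circ rho t)
                + Cconj (Ee t * (Ci * circ rho t)))%C).
  { intros t. apply wirtinger_chain; [|apply cderiv_circ].
    apply Hg, circ_in_disk, Hr. }
  assert (CG : ccont G) by (intro t; eapply cderiv_cont, DG).
  assert (DE : forall t, cderiv (fun s => cis (- (IZR k * s))) t
      (RtoC (IZR (- k)) * Ci * cis (- (IZR k * t)))%C).
  { intros t. apply cderiv_ext with (fun s => cis (IZR (- k) * s)).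
    - intros s. f_equal. rewrite opp_IZR. ring.
    - replace (- (IZR k * t)) with (IZR (- k) * t) by (rewrite opp_IZR; ring).
      apply cderiv_cis. }
  set (G' := fun t => (Ci * (RtoC rho * (Fe t * cis (IZR 1 * t))
       + RtoC (- rho) * Cconj (Ee t * cis (IZR 1 * t))))%C).
  assert (DG' : forall t, cderiv G t (G' t)).
  { intros t. eapply cderiv_eq; [|apply DG]. unfold G', circ.
    rewrite !Cmult_conj. replace (Cconj Ci) with (- Ci)%C by (apply C_ext; simpl; ring).
    replace (Cconj (RtoC rho)) with (RtoC rho) by (apply C_ext; simpl; ring).
    rewrite RtoC_opp. simpl. ring. }
  assert (C1 : ccont (fun t => (Fe t * cis (IZR 1 * t))%C))
    by (apply ccont_mult; auto using ccont_cis).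
  assert (C2 : ccont (fun t => (Ee t * cis (IZR 1 * t))%C))
    by (apply ccont_mult; auto using ccont_cis).
  assert (C2' : ccont (fun t => Cconj (Ee t * cis (IZR 1 * t))%C))
    by (intro; now apply cont_at_conj).
  assert (Cc : forall c, ccont (fun _ => c)) by (intros c t; apply cont_at_const).
  assert (CG' : ccont G').
  { apply ccont_mult; auto. intro t. apply cont_at_plus; apply ccont_mult; auto. }
  assert (E : CInt (fun t => (G' t * cis (- (IZR k * t)) +
     G t * (RtoC (IZR (- k)) * Ci * cis (- (IZR k * t))))%C) = 0%C).
  { rewrite (CInt_ftc (fun t => (G t * cis (- (IZR k * t)))%C)).
    - rewrite <- !cis_conj, cis_period, Rmult_0_r, cis_0.
      assert (EG : G (2 * PI) = G 0).
      { unfold G, circ. replace (1 * (2 * PI)) with (IZR 1 * (2 * PI)) by ring.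
        now rewrite cis_period, Rmult_0_r, cis_0. }
      rewrite EG. ring.
    - intros t. exact (cderiv_mult _ _ _ _ _ (DG' t) (DE t)).
    - intros t. apply cont_at_plus.
      + apply cont_at_mult; auto. apply ccont_cis_opp.
      + apply cont_at_mult; auto. apply cont_at_mult; [apply Cc|apply ccont_cis_opp]. }
  rewrite CInt_plus in E.
  2:{ apply ccont_mult; auto using ccont_cis_opp. }
  2:{ apply ccont_mult; auto. apply ccont_mult; auto using ccont_cis_opp. }
  fold (coef G' k) in E.
  rewrite (CInt_ext _ (fun t => (RtoC (IZR (- k)) * Ci * (G t * cis (- (IZR k * t))))%C)) in E
    by (intro; ring).
  rewrite CInt_scal in E by (apply ccont_mult; auto using ccont_cis_opp).
  fold (coef G k) in E.
  assert (E' : coef G' k = (Ci * (RtoC rho * coef Fe (k - 1)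
      + RtoC (- rho) * Cconj (coef Ee (- k - 1))))%C).
  { unfold G'. rewrite coef_scal.
    2:{ intro t. apply cont_at_plus; apply ccont_mult; auto. }
    rewrite coef_plus by (apply ccont_mult; auto).
    rewrite !coef_scal by auto. rewrite coef_conj by auto.
    now rewrite !coef_shift. }
  rewrite E', opp_IZR, !RtoC_opp in E.
  assert (Ci2 : (Ci * Ci)%C = (- 1)%C) by (apply C_ext; simpl; ring).
  transitivity (RtoC (IZR k) * coef G k + - Ci * 0)%C; [ring|].
  rewrite <- E.
  match goal with |- ?L = ?R => transitivity
    (R + (Ci * Ci + 1) * (RtoC (IZR k) * coef G k - R))%C; [ring|rewrite Ci2; ring] end.
Qed.

(** In [coef_derivative] at the frequencies [n + 1] and [- (n + 1)] one of the
    two terms is a coefficient of negative frequency of a holomorphic function,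
    hence 0. *)
Lemma coef_of_derivatives (rho : R) (g f e : C -> C) (n : nat) : 0 < rho < 1 ->
  harmonic_pair (disk 1) g f e ->
  rho * Cmod (coef (fun t => f (circ rho t)) (Z.of_nat n)) =
    INR (S n) * Cmod (coef (fun t => g (circ rho t)) (Z.of_nat (S n))) /\
  rho * Cmod (coef (fun t => e (circ rho t)) (Z.of_nat n)) =
    INR (S n) * Cmod (coef (fun t => g (circ rho t)) (- Z.of_nat (S n))).
Proof.
  intros Hr H. pose proof (lt_0_INR (S n) ltac:(lia)) as Hn.
  destruct (H) as [_ [[f' Hf] [e' He]]].
  split.
  - pose proof (coef_derivative rho g f e (Z.of_nat (S n)) Hr H) as E.
    replace (- Z.of_nat (S n) - 1)%Z with (- Z.of_nat (S (S n)))%Z in E by lia.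
    rewrite (coef_holomorphic_neg rho (S n) e e' Hr He) in E.
    apply (f_equal Cmod) in E.
    rewrite !Cmod_mult, !Cmod_R, <- INR_IZR_INZ, !Rabs_pos_eq in E by lra.
    rewrite E. replace (Cconj 0) with (RtoC 0) by (apply C_ext; simpl; ring).
    replace (Z.of_nat (S n) - 1)%Z with (Z.of_nat n) by lia.
    do 2 f_equal. ring.
  - pose proof (coef_derivative rho g f e (- Z.of_nat (S n)) Hr H) as E.
    replace (- Z.of_nat (S n) - 1)%Z with (- Z.of_nat (S (S n)))%Z in E by lia.
    rewrite (coef_holomorphic_neg rho (S n) f f' Hr Hf) in E.
    apply (f_equal Cmod) in E.
    rewrite !Cmod_mult, !Cmod_R, opp_IZR, <- INR_IZR_INZ, Rabs_Ropp, !Rabs_pos_eq in E by lra.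
    rewrite E. replace (- - Z.of_nat (S n) - 1)%Z with (Z.of_nat n) by lia.
    rewrite <- (Cmod_conj (coef _ _)), <- Cmod_opp. do 2 f_equal. ring.
Qed.

(** * Deviation of the derivatives from their values at the origin *)

(** The full series is that of [1 / (1 - x)^2], the derivative of
    [1 / (1 - x)], without its constant term; the remainder is explicit and
    nonnegative. *)
Lemma sum_weights (x : R) (N : nat) : 0 <= x < 1 ->
  sum_f_R0 (fun n => x ^ S n * INR (S (S n))) N <= 1 / (1 - x) ^ 2 - 1.
Proof.
  intros Hx.
  assert (E : sum_f_R0 (fun n => x ^ S n * INR (S (S n))) N =
    1 / (1 - x) ^ 2 - 1 -
      x ^ S (S N) * (INR (S (S (S N))) - INR (S (S N)) * x) / (1 - x) ^ 2).
  { induction N as [|N IH].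
    - simpl. field. lra.
    - rewrite tech5, IH. rewrite !S_INR. simpl pow. field. lra. }
  rewrite E.
  assert (0 <= x ^ S (S N) * (INR (S (S (S N))) - INR (S (S N)) * x) / (1 - x) ^ 2).
  { apply Rmult_le_pos.
    - apply Rmult_le_pos; [apply pow_le; lra|].
      rewrite (S_INR (S (S N))). pose proof (pos_INR (S (S N))). nra.
    - apply Rlt_le, Rinv_0_lt_compat, pow_lt. lra. }
  lra.
Qed.

Lemma le_of_left_limit (X s a : R) (phi : R -> R) : s < a -> continuous phi a ->
  (forall x, s < x < a -> X <= phi x) -> X <= phi a.
Proof.
  intros Hs Hc H. apply Rnot_lt_le. intro L.
  assert (E : locally a (fun r : R => phi r < X)).
  { apply (Hc (fun y => y < X)). apply (open_lt X). exact L. }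
  destruct E as [[d dp] Hd]; simpl in Hd.
  set (r := Rmax (a - d / 2) ((a + s) / 2)).
  assert (Hr : s < r < a).
  { unfold r; split; [eapply Rlt_le_trans; [|apply Rmax_r]; lra|].
    apply Rmax_lub_lt; lra. }
  specialize (H r Hr). apply (Rlt_irrefl X). eapply Rle_lt_trans; [apply H|].
  apply Hd. change (Rabs (r - a) < d). apply Rabs_lt_between.
  pose proof (Rmax_l (a - d / 2) ((a + s) / 2)) as Hl. fold r in Hl. lra.
Qed.

Section CoefficientBounds.

Context (M : R) (g f e : C -> C).
Context (pair_g : harmonic_pair (disk 1) g f e).
Context (bound_g : forall z, disk 1 z -> Cmod (g z) <= M).
Context (stretch_g : 1 <= Cmod (f 0) ^ 2 + Cmod (e 0) ^ 2).

Lemma circle_cont (rho : R) : 0 < rho < 1 -> ccont (fun t => g (circ rho t)).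
Proof.
  intros Hr t. eapply cderiv_cont, wirtinger_chain; [|apply cderiv_circ].
  now apply pair_g, circ_in_disk.
Qed.

Lemma coef_sum_le_4M (rho : R) (n : nat) : 0 < rho < 1 ->
  rho * (Cmod (coef (fun t => f (circ rho t)) (Z.of_nat n)) +
         Cmod (coef (fun t => e (circ rho t)) (Z.of_nat n))) <=
  INR (S n) * (2 * PI * (4 * M / PI)).
Proof.
  intros Hr. destruct (coef_of_derivatives rho g f e n Hr pair_g) as [E1 E2].
  rewrite Rmult_plus_distr_l, E1, E2, <- Rmult_plus_distr_l.
  apply Rmult_le_compat_l; [apply pos_INR|].
  replace (2 * PI * (4 * M / PI)) with (8 * M) by (field; apply PI_neq0).
  apply coef_pair_bound; [now apply circle_cont|lia|].
  intros t _. now apply bound_g, circ_in_disk.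
Qed.

(** Bessel's inequality for the frequencies [1], [-1], [N], [- N] with
    [N = n + 1 >= 2]. The first two contribute at least [rho^2] after
    normalisation, which leaves [M^2 - rho^2] for the other two. *)
Lemma coef_sum_le_sqrt (rho : R) (n : nat) : 0 < rho < 1 -> (1 <= n)%nat ->
  rho * (Cmod (coef (fun t => f (circ rho t)) (Z.of_nat n)) +
         Cmod (coef (fun t => e (circ rho t)) (Z.of_nat n))) <=
  INR (S n) * (2 * PI * sqrt (2 * M ^ 2 - 2 * rho ^ 2)).
Proof.
  intros Hr Hn. pose proof two_PI_pos.
  destruct (coef_of_derivatives rho g f e n Hr pair_g) as [E1 E2].
  rewrite Rmult_plus_distr_l, E1, E2, <- Rmult_plus_distr_l.
  apply Rmult_le_compat_l; [apply pos_INR|].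
  destruct (coef_of_derivatives rho g f e 0 Hr pair_g) as [F1 F2].
  destruct pair_g as [_ [[f' Hf] [e' He]]].
  change (Z.of_nat 0) with 0%Z in F1, F2. rewrite !coef_0 in F1, F2.
  rewrite (mean_value f f') in F1 by auto. rewrite (mean_value e e') in F2 by auto.
  rewrite Cmod_mult, Cmod_R, Rabs_pos_eq in F1, F2 by lra.
  change (INR 1) with 1 in F1, F2. rewrite Rmult_1_l in F1, F2.
  change (Z.of_nat 1) with 1%Z in F1, F2.
  set (G := fun t => g (circ rho t)) in *.
  assert (B := bessel G M (1 :: -1 :: Z.of_nat (S n) :: - Z.of_nat (S n) :: nil)%Z
    (circle_cont rho Hr)).
  cbv beta iota delta [list_sum] in B. change (- (1))%Z with (-1)%Z in F2.
  rewrite <- F1, <- F2 in B.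
  set (p := Cmod (coef G (Z.of_nat (S n)))) in *.
  set (q := Cmod (coef G (- Z.of_nat (S n)))) in *.
  assert (0 <= p) by apply Cmod_ge_0. assert (0 <= q) by apply Cmod_ge_0.
  apply Rsqr_incr_0_var.
  2:{ apply Rmult_le_pos; [lra|apply sqrt_pos]. }
  assert (L : p ^ 2 + q ^ 2 <= (2 * PI) ^ 2 * (M ^ 2 - rho ^ 2)).
  { assert (B' : (rho * (2 * PI * Cmod (f 0))) ^ 2 + ((rho * (2 * PI * Cmod (e 0))) ^ 2 +
      (p ^ 2 + (q ^ 2 + 0))) <= (2 * PI * M) ^ 2).
    { apply B.
      - repeat constructor; simpl; lia.
      - intros t _. now apply bound_g, circ_in_disk. }
    assert (0 <= (2 * PI * rho) ^ 2) by apply pow2_ge_0.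
    replace ((rho * (2 * PI * Cmod (f 0))) ^ 2) with
      ((2 * PI * rho) ^ 2 * Cmod (f 0) ^ 2) in B' by ring.
    replace ((rho * (2 * PI * Cmod (e 0))) ^ 2) with
      ((2 * PI * rho) ^ 2 * Cmod (e 0) ^ 2) in B' by ring.
    replace ((2 * PI) ^ 2 * (M ^ 2 - rho ^ 2)) with
      ((2 * PI * M) ^ 2 - (2 * PI * rho) ^ 2) by ring. nra. }
  assert (0 < (2 * PI) ^ 2) by (apply pow_lt; lra).
  assert (P : 0 <= M ^ 2 - rho ^ 2).
  { pose proof (pow2_ge_0 p). pose proof (pow2_ge_0 q).
    apply Rmult_le_reg_l with ((2 * PI) ^ 2); lra. }
  rewrite Rsqr_mult, Rsqr_sqrt by lra. rewrite !Rsqr_pow2.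
  pose proof (pow2_ge_0 (p - q)). nra.
Qed.

(** Cauchy's formula on the circle of radius [rho], expanded at [z / rho]. The
    constant terms are [f 0] and [e 0], and the weights [n + 1] of the other
    coefficients sum up as in [sum_weights]. *)
Lemma deviation_of_coef_bound (rho c : R) (z : C) : 0 < rho < 1 -> Cmod z < rho ->
  (forall n, (1 <= n)%nat ->
    rho * (Cmod (coef (fun t => f (circ rho t)) (Z.of_nat n)) +
           Cmod (coef (fun t => e (circ rho t)) (Z.of_nat n))) <=
    INR (S n) * (2 * PI * c)) ->
  Cmod (f z - f 0) + Cmod (e z - e 0) <=
  c * (/ rho * (1 / (1 - Cmod z / rho) ^ 2 - 1)).
Proof.
  intros Hr Hz Hc. pose proof two_PI_pos.
  (* The kernel lives on the unit circle, where [z] corresponds to [w]. *)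
  set (w := (RtoC (/ rho) * z)%C).
  assert (Hw : Cmod w = Cmod z / rho).
  { unfold w. rewrite Cmod_mult, Cmod_R, Rabs_pos_eq; [unfold Rdiv; ring|].
    apply Rlt_le, Rinv_0_lt_compat; lra. }
  assert (Ez : (RtoC rho * w)%C = z).
  { unfold w. rewrite Cmult_assoc, <- RtoC_mult, Rinv_r by lra. ring. }
  assert (Hw1 : 0 <= Cmod w < 1).
  { split; [apply Cmod_ge_0|]. rewrite Hw. apply Rmult_lt_reg_r with rho; [lra|].
    unfold Rdiv. rewrite Rmult_assoc, Rinv_l by lra. lra. }
  destruct pair_g as [_ [[f' Hf] [e' He]]].
  destruct (kernel_expansion _ w (holomorphic_circ_cont f f' rho Hr Hf) (proj2 Hw1))
    as [B1 [B1p H1]].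
  destruct (kernel_expansion _ w (holomorphic_circ_cont e e' rho Hr He) (proj2 Hw1))
    as [B2 [B2p H2]].
  rewrite (cauchy_formula f f'), (mean_value f f'), Ez in H1 by (auto; lra).
  rewrite (cauchy_formula e e'), (mean_value e e'), Ez in H2 by (auto; lra).
  apply Rmult_le_reg_l with (2 * PI); [lra|].
  apply le_of_le_geometric with (Cmod w) (B1 + B2); [lra|lra|].
  intros N. specialize (H1 N). specialize (H2 N).
  assert (D : forall u v, Cmod (RtoC (2 * PI) * u - RtoC (2 * PI) * v)%C =
                          2 * PI * Cmod (u - v)%C).
  { intros u v. replace (RtoC (2 * PI) * u - RtoC (2 * PI) * v)%C with
      (RtoC (2 * PI) * (u - v))%C by ring.
    now rewrite Cmod_mult, Cmod_R, Rabs_pos_eq by lra. }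
  rewrite D in H1, H2.
  assert (S1 : sum_f_R0 (fun n => Cmod w ^ S n *
        Cmod (coef (fun t => f (circ rho t)) (Z.of_nat (S n)))) N +
      sum_f_R0 (fun n => Cmod w ^ S n *
        Cmod (coef (fun t => e (circ rho t)) (Z.of_nat (S n)))) N <=
      2 * PI * c * / rho * sum_f_R0 (fun n => Cmod w ^ S n * INR (S (S n))) N).
  { rewrite <- sum_plus, scal_sum. apply sum_Rle. intros n _.
    rewrite <- Rmult_plus_distr_l, Rmult_assoc.
    apply Rmult_le_compat_l; [apply pow_le; lra|].
    specialize (Hc (S n) ltac:(lia)).
    apply Rmult_le_reg_l with rho; [lra|]. eapply Rle_trans; [apply Hc|].
    right. field. lra. }
  assert (c0 : 0 <= c).
  { specialize (Hc 1%nat ltac:(lia)).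
    pose proof (Cmod_ge_0 (coef (fun t => f (circ rho t)) (Z.of_nat 1))).
    pose proof (Cmod_ge_0 (coef (fun t => e (circ rho t)) (Z.of_nat 1))).
    apply Rmult_le_reg_l with (2 * (2 * PI)); [lra|]. rewrite Rmult_0_r.
    change (INR 2) with 2 in Hc. nra. }
  assert (S2 : 2 * PI * c * / rho * sum_f_R0 (fun n => Cmod w ^ S n * INR (S (S n))) N
     <= 2 * PI * c * / rho * (1 / (1 - Cmod w) ^ 2 - 1)).
  { apply Rmult_le_compat_l; [|now apply sum_weights].
    apply Rmult_le_pos; [nra|]. apply Rlt_le, Rinv_0_lt_compat; lra. }
  rewrite Rmult_plus_distr_l, <- Hw.
  replace (2 * PI * (c * (/ rho * (1 / (1 - Cmod w) ^ 2 - 1)))) with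
    (2 * PI * c * / rho * (1 / (1 - Cmod w) ^ 2 - 1)) by ring.
  lra.
Qed.

(** Both coefficient bounds are continuous in [rho] up to [rho = 1], where they
    become the two terms of the minimum that defines [K M]. *)
Lemma gradient_deviation (z : C) : disk 1 z ->
  Cmod (f z - f 0) + Cmod (e z - e 0) <= K M * (1 / (1 - Cmod z) ^ 2 - 1).
Proof.
  intros Hz. unfold disk in Hz. pose proof (Cmod_ge_0 z) as Hz0.
  set (X := Cmod (f z - f 0) + Cmod (e z - e 0)).
  assert (L : forall phi : R -> R, continuous phi 1 ->
    (forall rho n, Cmod z < rho < 1 -> (1 <= n)%nat ->
      rho * (Cmod (coef (fun t => f (circ rho t)) (Z.of_nat n)) +
         Cmod (coef (fun t => e (circ rho t)) (Z.of_nat n))) <=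
      INR (S n) * (2 * PI * phi rho)) ->
    X <= phi 1 * (1 / (1 - Cmod z) ^ 2 - 1)).
  { intros phi Hphi H.
    replace (1 / (1 - Cmod z) ^ 2 - 1) with (/ 1 * (1 / (1 - Cmod z / 1) ^ 2 - 1))
      by (field; lra).
    apply (le_of_left_limit X (Cmod z) 1
      (fun rho => phi rho * (/ rho * (1 / (1 - Cmod z / rho) ^ 2 - 1)))); auto.
    - apply (continuous_mult (K := R_AbsRing)); auto.
      apply (ex_derive_continuous (K := R_AbsRing) (V := R_NormedModule)
        (fun rho => / rho * (1 / (1 - Cmod z / rho) ^ 2 - 1))).
      auto_derive. repeat split; try lra. rewrite Rinv_1. nra.
    - intros rho Hr. apply deviation_of_coef_bound; try lra.
      intros n Hn. apply H; auto. }
  unfold K. unfold Rmin. destruct Rle_dec as [_|_].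
  - replace (2 * M ^ 2 - 2) with (2 * M ^ 2 - 2 * 1 ^ 2) by ring.
    apply (L (fun rho => sqrt (2 * M ^ 2 - 2 * rho ^ 2))).
    + apply (continuous_comp (fun rho => 2 * M ^ 2 - 2 * rho ^ 2) sqrt).
      * apply (ex_derive_continuous (K := R_AbsRing) (V := R_NormedModule)
          (fun rho => 2 * M ^ 2 - 2 * rho ^ 2)). auto_derive; auto.
      * apply continuous_sqrt.
    + intros rho n Hr Hn. apply coef_sum_le_sqrt; auto; lra.
  - apply (L (fun _ => 4 * M / PI)); [apply continuous_const|].
    intros rho n Hr Hn. apply coef_sum_le_4M; auto; lra.
Qed.

End CoefficientBounds.

(** * Zeros of monotone maps *)

Lemma Cmod2_minus (z w : C) :
  Cmod (z - w)%C ^ 2 = Cmod z ^ 2 - 2 * dot z w + Cmod w ^ 2.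
Proof. rewrite !Cmod2_alt. unfold dot; simpl; unfold Re, Im; ring. Qed.

Lemma Cmod_le_of_sq (z : C) (B : R) : 0 <= B -> Cmod z ^ 2 <= B ^ 2 -> Cmod z <= B.
Proof.
  intros HB H. apply Rsqr_incr_0_var; auto. rewrite !Rsqr_pow2. exact H.
Qed.

Definition lipschitz_on (rho L : R) (A : C -> C) : Prop :=
  forall z w, Cmod z <= rho -> Cmod w <= rho ->
    Cmod (A z - A w)%C <= L * Cmod (z - w)%C.

(** If [A] had no zero, every point [(u, v)] of the square around the disk would
    have a neighbourhood of size [delta u v] on which [|A|] is bounded below in
    terms of [delta u v], or which misses the disk. Compactness makes this
    uniform. *)
Lemma lipschitz_zero_of_inf (rho L : R) (A : C -> C) : 0 <= L ->
  lipschitz_on rho L A ->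
  (forall eta, 0 < eta -> exists z, Cmod z <= rho /\ Cmod (A z) < eta) ->
  exists z, Cmod z <= rho /\ A z = 0%C.
Proof.
  intros HL HA Hinf. apply NNPP. intro Hno.
  assert (Hpos : forall z, Cmod z <= rho -> 0 < Cmod (A z)).
  { intros z Hz. apply Cmod_gt_0. intro E. apply Hno. now exists z. }
  (* The constants leave room for a displacement of at most twice the size in
     the Euclidean norm. *)
  set (h := fun u v => if Rle_dec (Cmod (u, v)) rho
    then Cmod (A (u, v)) / (4 * (L + 1)) else (Cmod (u, v) - rho) / 4).
  assert (hpos : forall u v, 0 < h u v).
  { intros u v. unfold h. destruct Rle_dec as [k|k]; [|lra].
    apply Rdiv_lt_0_compat; [now apply Hpos|lra]. }
  set (delta := fun u v => mkposreal (h u v) (hpos u v)).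
  assert (Hdelta : forall u v,
    (Cmod (u, v) <= rho -> 4 * (L + 1) * delta u v = Cmod (A (u, v))) /\
    (rho < Cmod (u, v) -> 4 * delta u v = Cmod (u, v) - rho)).
  { intros u v. simpl. unfold h. destruct Rle_dec as [k|k]; split; intro; try lra.
    field. lra. }
  clearbody delta. clear h hpos.
  destruct (compactness_value_2d (- rho) rho (- rho) rho delta) as [d Hcomp].
  destruct (Hinf (2 * (L + 1) * d)) as [z [Hz HAz]].
  { apply Rmult_lt_0_compat; [lra|apply cond_pos]. }
  destruct z as [x y].
  pose proof (Rmax_Cmod (x, y)) as Hm. simpl in Hm.
  apply (Hcomp x y).
  { apply Rabs_le_between. pose proof (Rmax_l (Rabs x) (Rabs y)). lra. }
  { apply Rabs_le_between. pose proof (Rmax_r (Rabs x) (Rabs y)). lra. }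
  intros [u [v [_ [_ [Hu [Hv Hduv]]]]]].
  destruct (Hdelta u v) as [D1 D2].
  assert (Hdist : Cmod ((u, v) - (x, y))%C <= 2 * delta u v).
  { eapply Rle_trans; [apply Cmod_le_Rabs|]. simpl.
    change (Rabs (u - x) + Rabs (v - y) <= 2 * delta u v).
    rewrite (Rabs_minus_sym u), (Rabs_minus_sym v). lra. }
  pose proof (cond_pos (delta u v)).
  destruct (Rle_dec (Cmod (u, v)) rho) as [h|h].
  - specialize (D1 h). specialize (HA (u, v) (x, y) h Hz).
    assert (T : Cmod (A (u, v)) <= Cmod (A (u, v) - A (x, y))%C + Cmod (A (x, y))).
    { replace (A (u, v)) with ((A (u, v) - A (x, y)) + A (x, y))%C at 1 by ring.
      apply Cmod_triangle. }
    nra.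
  - specialize (D2 ltac:(lra)).
    assert (T : Cmod (u, v) <= Cmod ((u, v) - (x, y))%C + Cmod (x, y)).
    { replace (u, v) with (((u, v) - (x, y)) + (x, y))%C at 1 by ring.
      apply Cmod_triangle. }
    lra.
Qed.

(** For small [tau] the map [z |-> z - tau B z] sends the closed disk to itself,
    by the boundary condition, and is a contraction, by strong monotonicity. The
    steps of its iteration have length [tau |B z|] and tend to 0. *)
Lemma strongly_monotone_small_value (rho L eps delta c : R) (B : C -> C) :
  0 < L -> 0 < eps -> 0 < delta -> 0 < c -> 0 < rho ->
  lipschitz_on rho L B ->
  (forall z w, Cmod z <= rho -> Cmod w <= rho ->
     eps * Cmod (z - w)%C ^ 2 <= dot (z - w)%C (B z - B w)%C) ->
  (forall z, rho - delta <= Cmod z <= rho -> c <= dot z (B z)) ->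
  forall eta, 0 < eta -> exists z, Cmod z <= rho /\ Cmod (B z) < eta.
Proof.
  intros HL He Hd Hc Hrho HB Hm Hb eta Heta.
  set (b := Cmod (B 0) + L * rho + 1).
  assert (Hbd : forall z, Cmod z <= rho -> Cmod (B z) <= b).
  { intros z Hz. assert (h : Cmod (B z - B 0)%C <= L * Cmod (z - 0)%C).
    { apply HB; auto. rewrite Cmod_0; lra. }
    replace (z - 0)%C with z in h by ring.
    assert (Cmod (B z) <= Cmod (B z - B 0)%C + Cmod (B 0)).
    { replace (B z) with ((B z - B 0) + B 0)%C at 1 by ring. apply Cmod_triangle. }
    unfold b. nra. }
  assert (b1 : 1 <= b) by (unfold b; pose proof (Cmod_ge_0 (B 0)); nra).
  assert (Htau : exists tau, 0 < tau /\ tau * L ^ 2 <= eps /\ tau * b <= delta /\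
     tau * b ^ 2 <= 2 * c /\ tau * eps <= 1).
  { (* The constraints give, in this order: contraction, stability of the inner
       disk, stability near the boundary, and a nonnegative ratio. *)
    assert (L2 : 0 < L ^ 2) by (apply pow_lt; lra).
    assert (b2 : 0 < b ^ 2) by (apply pow_lt; lra).
    exists (Rmin (Rmin (eps / L ^ 2) (delta / b)) (Rmin (2 * c / b ^ 2) (1 / eps))).
    assert (M : forall a t x, 0 < x -> t <= a / x -> t * x <= a).
    { intros a t x Hx Ht. apply (Rmult_le_compat_r x) in Ht; [|lra].
      unfold Rdiv in Ht. rewrite Rmult_assoc, Rinv_l in Ht by lra. lra. }
    split; [|split; [|split; [|split]]].
    - repeat apply Rmin_pos; apply Rdiv_lt_0_compat; lra.
    - apply M; auto. eapply Rle_trans; [apply Rmin_l|apply Rmin_l].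
    - apply M; [lra|]. eapply Rle_trans; [apply Rmin_l|apply Rmin_r].
    - apply M; auto. eapply Rle_trans; [apply Rmin_r|apply Rmin_l].
    - apply M; auto. eapply Rle_trans; [apply Rmin_r|apply Rmin_r]. }
  destruct Htau as [tau [t0 [t1 [t2 [t3 t4]]]]].
  set (T := fun z => (z - RtoC tau * B z)%C).
  assert (Tself : forall z, Cmod z <= rho -> Cmod (T z) <= rho).
  { intros z Hz. specialize (Hbd z Hz).
    assert (Ht : Cmod (RtoC tau * B z)%C = tau * Cmod (B z))
      by now rewrite Cmod_mult, Cmod_R, Rabs_pos_eq by lra.
    pose proof (Cmod_ge_0 (B z)).
    destruct (Rle_dec (rho - delta) (Cmod z)) as [h|h].
    - specialize (Hb z (conj h Hz)). apply Cmod_le_of_sq; [lra|].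
      unfold T. rewrite Cmod2_minus, Ht.
      replace (dot z (RtoC tau * B z)%C) with (tau * dot z (B z))
        by (unfold dot; simpl; unfold Re, Im; ring).
      assert (Cmod z ^ 2 <= rho ^ 2) by (apply pow_incr; split; [apply Cmod_ge_0|lra]).
      assert (Cmod (B z) ^ 2 <= b ^ 2) by (apply pow_incr; lra).
      assert ((tau * Cmod (B z)) ^ 2 <= tau * (2 * c)) by
        (replace ((tau * Cmod (B z)) ^ 2) with (tau * (tau * Cmod (B z) ^ 2)) by ring;
         apply Rmult_le_compat_l; nra).
      nra.
    - unfold T. eapply Rle_trans; [apply Cmod_triangle|].
      rewrite Cmod_opp, Ht. nra. }
  assert (Tcontr : forall z w, Cmod z <= rho -> Cmod w <= rho ->
     Cmod (T z - T w)%C ^ 2 <= (1 - tau * eps) * Cmod (z - w)%C ^ 2).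
  { intros z w Hz Hw. specialize (HB z w Hz Hw). specialize (Hm z w Hz Hw).
    unfold T.
    replace (z - RtoC tau * B z - (w - RtoC tau * B w))%C with
      ((z - w) - RtoC tau * (B z - B w))%C by ring.
    rewrite Cmod2_minus, Cmod_mult, Cmod_R, Rabs_pos_eq by lra.
    replace (dot (z - w)%C (RtoC tau * (B z - B w))%C) with
      (tau * dot (z - w)%C (B z - B w)%C) by (unfold dot; simpl; unfold Re, Im; ring).
    set (d := Cmod (z - w)%C) in *. set (k := Cmod (B z - B w)%C) in *.
    assert (0 <= k) by apply Cmod_ge_0. assert (0 <= d) by apply Cmod_ge_0.
    assert (k ^ 2 <= (L * d) ^ 2) by (apply pow_incr; lra).
    assert (tau * k ^ 2 <= eps * d ^ 2).
    { apply Rle_trans with (tau * (L * d) ^ 2); [apply Rmult_le_compat_l; lra|].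
      replace (tau * (L * d) ^ 2) with (tau * L ^ 2 * d ^ 2) by ring.
      apply Rmult_le_compat_r; [apply pow2_ge_0|lra]. }
    replace ((tau * k) ^ 2) with (tau * (tau * k ^ 2)) by ring. nra. }
  set (z := fix z (n : nat) : C := match n with O => 0%C | S m => T (z m) end).
  assert (Hz : forall n, Cmod (z n) <= rho).
  { induction n as [|n IH]; simpl; [rewrite Cmod_0; lra|auto]. }
  assert (Hstep : forall n, Cmod (z (S n) - z n)%C ^ 2 <=
     (1 - tau * eps) ^ n * Cmod (z 1%nat - z 0%nat)%C ^ 2).
  { induction n as [|n IH]; [simpl; lra|].
    eapply Rle_trans; [apply (Tcontr (z (S n)) (z n)); auto|].
    change ((1 - tau * eps) ^ S n) with ((1 - tau * eps) * (1 - tau * eps) ^ n).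
    rewrite Rmult_assoc. apply Rmult_le_compat_l; [lra|exact IH]. }
  assert (te : 0 < tau * eps) by nra.
  set (D := Cmod (z 1%nat - z 0%nat)%C ^ 2) in *.
  assert (D0 : 0 <= D) by apply pow2_ge_0.
  assert (Y : 0 < (tau * eta) ^ 2 / (D + 1)).
  { apply Rdiv_lt_0_compat; [apply pow_lt; nra|lra]. }
  destruct (pow_lt_1_zero (1 - tau * eps) ltac:(rewrite Rabs_pos_eq; lra) _ Y) as [N HN].
  specialize (HN N ltac:(lia)). rewrite Rabs_pos_eq in HN by (apply pow_le; lra).
  exists (z N). split; auto.
  specialize (Hstep N).
  assert (Es : Cmod (z (S N) - z N)%C = tau * Cmod (B (z N))).
  { change (z (S N)) with (T (z N)). unfold T.
    replace (z N - RtoC tau * B (z N) - z N)%C with (- (RtoC tau * B (z N)))%C by ring.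
    now rewrite Cmod_opp, Cmod_mult, Cmod_R, Rabs_pos_eq by lra. }
  rewrite Es in Hstep.
  apply (Rmult_lt_compat_r (D + 1)) in HN; [|lra].
  unfold Rdiv in HN. rewrite Rmult_assoc, Rinv_l in HN by lra.
  assert (Q : 0 <= (1 - tau * eps) ^ N) by (apply pow_le; lra).
  apply Rmult_lt_reg_l with tau; auto.
  apply Rsqr_incrst_0; [|pose proof (Cmod_ge_0 (B (z N))); nra|nra].
  rewrite !Rsqr_pow2. nra.
Qed.

(** Adding [eps z] makes [A] strongly monotone and keeps the boundary
    condition; small values of the sum are small values of [A] when [eps] is
    small. *)
Lemma monotone_zero (rho L delta c : R) (A : C -> C) :
  0 <= L -> 0 < delta -> 0 < c -> 0 < rho ->
  lipschitz_on rho L A ->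
  (forall z w, Cmod z <= rho -> Cmod w <= rho ->
     0 <= dot (z - w)%C (A z - A w)%C) ->
  (forall z, rho - delta <= Cmod z <= rho -> c <= dot z (A z)) ->
  exists z, Cmod z <= rho /\ A z = 0%C.
Proof.
  intros HL Hd Hc Hrho HA Hm Hb.
  apply (lipschitz_zero_of_inf rho L); auto.
  intros eta Heta.
  set (eps := eta / (2 * (rho + 1))).
  assert (He : 0 < eps) by (apply Rdiv_lt_0_compat; lra).
  assert (Ee : eps * (rho + 1) = eta / 2) by (unfold eps; field; lra).
  destruct (strongly_monotone_small_value rho (L + eps) eps delta c
    (fun z => A z + RtoC eps * z)%C) with (eta := eta / 2) as [z [Hz HB]]; auto; try lra.
  - intros z w Hz Hw. specialize (HA z w Hz Hw).
    replace (A z + RtoC eps * z - (A w + RtoC eps * w))%C with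
      ((A z - A w) + RtoC eps * (z - w))%C by ring.
    eapply Rle_trans; [apply Cmod_triangle|].
    rewrite Cmod_mult, Cmod_R, (Rabs_pos_eq eps) by lra. lra.
  - intros z w Hz Hw. specialize (Hm z w Hz Hw).
    replace (A z + RtoC eps * z - (A w + RtoC eps * w))%C with
      ((A z - A w) + RtoC eps * (z - w))%C by ring.
    rewrite <- dot_self.
    replace (dot (z - w)%C (A z - A w + RtoC eps * (z - w))%C) with
      (dot (z - w)%C (A z - A w)%C + eps * dot (z - w)%C (z - w)%C); [lra|].
    unfold dot; simpl; unfold Re, Im; ring.
  - intros z Hz. specialize (Hb z Hz).
    replace (dot z (A z + RtoC eps * z)%C) with (dot z (A z) + eps * dot z z)
      by (unfold dot; simpl; unfold Re, Im; ring).
    rewrite dot_self. pose proof (pow2_ge_0 (Cmod z)). nra.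
  - exists z. split; auto.
    assert (T : Cmod (A z) <= Cmod (A z + RtoC eps * z)%C + Cmod (- (RtoC eps * z))%C).
    { replace (A z) with ((A z + RtoC eps * z) + - (RtoC eps * z))%C at 1 by ring.
      apply Cmod_triangle. }
    rewrite Cmod_opp, Cmod_mult, Cmod_R, (Rabs_pos_eq eps) in T by lra.
    pose proof (Cmod_ge_0 z). nra.
Qed.

(** * Maps close to the identity, multiplied by the squared modulus *)

Lemma dot_mean_value (P : R -> C) (dP : R -> C) (u : C) (a b : R) : a < b ->
  (forall t, a <= t <= b -> cderiv P t (dP t)) ->
  exists c, a < c < b /\ dot u (P b - P a)%C = dot u (dP c) * (b - a).
Proof.
  intros Hab H.
  destruct (MVT_cor2 (fun t => dot u (P t)) (fun t => dot u (dP t)) a b Hab)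
    as [c [E Hc]].
  - intros t Ht. destruct (H t Ht) as [h1 h2]. apply is_derive_Reals in h1, h2.
    exact (derivable_pt_lim_plus _ _ _ _ _
      (derivable_pt_lim_scal _ (Re u) _ _ h1) (derivable_pt_lim_scal _ (Im u) _ _ h2)).
  - exists c. split; auto. rewrite <- E. unfold dot; simpl; unfold Re, Im; ring.
Qed.

Lemma segment_norm (z w : C) (t B : R) : 0 <= t <= 1 -> Cmod z <= B -> Cmod w <= B ->
  Cmod (z + RtoC t * (w - z))%C <= B.
Proof.
  intros Ht Hz Hw.
  replace (z + RtoC t * (w - z))%C with (RtoC (1 - t) * z + RtoC t * w)%C
    by (rewrite RtoC_minus; ring).
  eapply Rle_trans; [apply Cmod_triangle|].
  rewrite !Cmod_mult, !Cmod_R, !Rabs_pos_eq by lra. nra.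
Qed.

Lemma cderiv_Cmod2 (z v : C) (t : R) :
  cderiv (fun s => RtoC (Cmod (z + RtoC s * v)%C ^ 2)) t
    (RtoC (2 * dot (z + RtoC t * v)%C v)).
Proof.
  apply cderiv_RtoC.
  apply is_derive_ext with
    (fun s => (Re z + s * Re v) ^ 2 + (Im z + s * Im v) ^ 2).
  - intros s. rewrite Cmod2_alt. simpl. unfold Re, Im. ring.
  - auto_derive; auto. unfold dot; simpl. unfold Re, Im. ring.
Qed.

Definition directional (G : C -> C) (dG : C -> C -> C) : Prop :=
  forall z v t, disk 1 (z + RtoC t * v)%C ->
    cderiv (fun s => G (z + RtoC s * v)%C) t (dG (z + RtoC t * v)%C v).

Section NearIdentity.

Context (k : R) (G : C -> C) (dG : C -> C -> C).
Context (k_pos : 0 <= k) (G_dir : directional G dG).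
Context (G_near : forall z, disk 1 z ->
  Cmod (G z - z)%C <= k * (Cmod z ^ 2 / (1 - Cmod z))).
Context (dG_near : forall z v, disk 1 z ->
  Cmod (dG z v - v)%C <= k * (1 / (1 - Cmod z) ^ 2 - 1) * Cmod v).

Definition dF (z v : C) : C :=
  (RtoC (2 * dot z v) * G z + RtoC (Cmod z ^ 2) * dG z v)%C.

Lemma F_directional : directional (F G) dF.
Proof.
  intros z v t Hz.
  exact (cderiv_mult _ _ _ _ _ (cderiv_Cmod2 z v t) (G_dir z v t Hz)).
Qed.

(** [dF z v = 2 <z, v> G z + |z|^2 dG z v]. Replacing [G z] by [z] and [dG z v]
    by [v], the product with [v] is [2 <z, v>^2 + |z|^2 |v|^2], of which the
    square is dropped. With [s = |z|] the errors cost [s^2 |v|^2 k] times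
    [2 s / (1 - s) + 1 / (1 - s)^2 - 1], which is the sum in the statement. *)
Lemma dF_coercive (z v : C) : disk 1 z ->
  Cmod z ^ 2 * Cmod v ^ 2 *
    (1 - k * (4 * (Cmod z / (1 - Cmod z)) + Cmod z ^ 2 / (1 - Cmod z) ^ 2))
  <= dot v (dF z v).
Proof.
  intros Hz. pose proof (G_near z Hz) as E1. pose proof (dG_near z v Hz) as E2.
  unfold disk in Hz.
  replace (dot v (dF z v)) with
    (2 * dot z v * (dot z v + dot v (G z - z)%C) +
     Cmod z ^ 2 * (dot v v + dot v (dG z v - v)%C)).
  2:{ unfold dF, dot; simpl; unfold Re, Im; ring. }
  rewrite dot_self.
  pose proof (dot_abs_le z v) as A0.
  pose proof (dot_abs_le v (G z - z)%C) as A1.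
  pose proof (dot_abs_le v (dG z v - v)%C) as A2.
  pose proof (Cmod_ge_0 z). pose proof (Cmod_ge_0 v).
  set (s := Cmod z) in *. set (n := Cmod v) in *.
  set (g1 := k * (s ^ 2 / (1 - s))) in *.
  set (g2 := k * (1 / (1 - s) ^ 2 - 1)) in *.
  assert (B1 : Rabs (dot v (G z - z)%C) <= n * g1).
  { eapply Rle_trans; [apply A1|]. now apply Rmult_le_compat_l. }
  assert (B2 : - (n * (g2 * n)) <= dot v (dG z v - v)%C).
  { assert (n * Cmod (dG z v - v)%C <= n * (g2 * n)) by now apply Rmult_le_compat_l.
    pose proof (Rle_abs (- dot v (dG z v - v)%C)) as Q. rewrite Rabs_Ropp in Q. lra. }
  assert (B3 : - (s * n * (n * g1)) <= dot z v * dot v (G z - z)%C).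
  { pose proof (Rle_abs (- (dot z v * dot v (G z - z)%C))) as Q.
    rewrite Rabs_Ropp, Rabs_mult in Q.
    assert (Rabs (dot z v) * Rabs (dot v (G z - z)%C) <= s * n * (n * g1))
      by (apply Rmult_le_compat; auto using Rabs_pos). lra. }
  assert (B4 : s ^ 2 * - (n * (g2 * n)) <= s ^ 2 * dot v (dG z v - v)%C)
    by (apply Rmult_le_compat_l; [apply pow2_ge_0|auto]).
  replace (s ^ 2 * n ^ 2 * (1 - k * (4 * (s / (1 - s)) + s ^ 2 / (1 - s) ^ 2))) with
    (s ^ 2 * n ^ 2 + s ^ 2 * - (n * (g2 * n)) + 2 * - (s * n * (n * g1))).
  2:{ unfold g1, g2. field. lra. }
  pose proof (pow2_ge_0 (dot z v)). nra.
Qed.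

(** The derivative along the segment can vanish only where the segment meets 0.
    The mean values over the two halves of the segment are attained at distinct
    points, of which at most one is 0. *)
Lemma F_strictly_monotone (r : R) (z w : C) : r <= 1 ->
  (forall s, 0 <= s < r ->
     k * (4 * (s / (1 - s)) + s ^ 2 / (1 - s) ^ 2) < 1) ->
  disk r z -> disk r w -> z <> w ->
  0 < dot (w - z)%C (F G w - F G z)%C.
Proof.
  intros Hr Hk Hz Hw Hne. set (v := (w - z)%C).
  assert (Hv : 0 < Cmod v).
  { apply Cmod_gt_0. intro E. apply Hne.
    transitivity (w - v)%C; [unfold v; ring|rewrite E; ring]. }
  assert (Hseg : forall t, 0 <= t <= 1 -> disk r (z + RtoC t * v)%C).
  { intros t Ht. unfold disk in *.
    apply Rle_lt_trans with (Rmax (Cmod z) (Cmod w)).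
    - apply segment_norm; [auto|apply Rmax_l|apply Rmax_r].
    - now apply Rmax_lub_lt. }
  assert (Hd1 : forall z, disk r z -> disk 1 z) by (unfold disk; intros; lra).
  assert (Hge : forall y, disk r y -> 0 <= dot v (dF y v) /\
                 (y <> 0%C -> 0 < dot v (dF y v))).
  { intros y Hy. pose proof (dF_coercive y v (Hd1 y Hy)) as C.
    specialize (Hk (Cmod y) (conj (Cmod_ge_0 y) Hy)).
    assert (P : 0 <= Cmod y ^ 2 * Cmod v ^ 2)
      by (apply Rmult_le_pos; apply pow2_ge_0).
    split; [nra|]. intros H0. apply Cmod_gt_0 in H0.
    assert (0 < Cmod y ^ 2 * Cmod v ^ 2)
      by (apply Rmult_lt_0_compat; apply pow_lt; auto).
    nra. }
  set (P := fun t => F G (z + RtoC t * v)%C).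
  assert (HP : forall t, 0 <= t <= 1 -> cderiv P t (dF (z + RtoC t * v)%C v)).
  { intros t Ht. apply F_directional. auto. }
  destruct (dot_mean_value P (fun t => dF (z + RtoC t * v)%C v) v 0 (1/2))
    as [c1 [Hc1 E1]]; [lra|intros; apply HP; lra|].
  destruct (dot_mean_value P (fun t => dF (z + RtoC t * v)%C v) v (1/2) 1)
    as [c2 [Hc2 E2]]; [lra|intros; apply HP; lra|].
  replace (F G w - F G z)%C with ((P 1 - P (1/2)%R) + (P (1/2)%R - P 0))%C.
  2:{ unfold P. replace (z + RtoC 1 * v)%C with w by (unfold v; ring).
      replace (z + RtoC 0 * v)%C with z by ring. ring. }
  replace (dot v (P 1 - P (1 / 2)%R + (P (1 / 2)%R - P 0))%C) with
    (dot v (P 1 - P (1 / 2)%R)%C + dot v (P (1 / 2)%R - P 0)%C)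
    by (unfold dot; simpl; unfold Re, Im; ring).
  rewrite E1, E2.
  destruct (Hge _ (Hseg c1 ltac:(lra))) as [G1 S1].
  destruct (Hge _ (Hseg c2 ltac:(lra))) as [G2 S2].
  assert (N : (z + RtoC c1 * v)%C <> 0%C \/ (z + RtoC c2 * v)%C <> 0%C).
  { destruct (classic ((z + RtoC c1 * v)%C = 0%C)) as [Z1|Z1]; [right|now left].
    intros Z2.
    assert (Z : (RtoC (c2 - c1) * v)%C = 0%C).
    { rewrite RtoC_minus.
      transitivity ((z + RtoC c2 * v) - (z + RtoC c1 * v))%C; [ring|].
      rewrite Z1, Z2. ring. }
    apply (f_equal Cmod) in Z. rewrite Cmod_mult, Cmod_R, Cmod_0, Rabs_pos_eq in Z by lra.
    nra. }
  destruct N as [N|N]; [specialize (S1 N)|specialize (S2 N)]; nra.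
Qed.

Lemma F_lipschitz (rho : R) : 0 < rho < 1 ->
  exists L, 0 <= L /\ lipschitz_on rho L (F G).
Proof.
  intros Hr.
  set (L := 2 * (1 + k / (1 - rho)) + (1 + k / (1 - rho) ^ 2)).
  assert (K1 : 0 <= k / (1 - rho)) by (apply Rdiv_le_0_compat; lra).
  assert (K2 : 0 <= k / (1 - rho) ^ 2)
    by (apply Rdiv_le_0_compat; [lra|apply pow_lt; lra]).
  exists L. split; [unfold L; lra|].
  assert (D : forall y v, Cmod y <= rho -> Cmod (dF y v) <= L * Cmod v).
  { intros y v Hy. assert (Hy1 : disk 1 y) by (unfold disk; lra).
    pose proof (G_near y Hy1) as E1. pose proof (dG_near y v Hy1) as E2.
    pose proof (Cmod_ge_0 y). pose proof (Cmod_ge_0 v).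
    assert (A1 : Cmod (G y) <= 1 + k / (1 - rho)).
    { assert (T : Cmod (G y) <= Cmod (G y - y)%C + Cmod y).
      { replace (G y) with ((G y - y) + y)%C at 1 by ring. apply Cmod_triangle. }
      assert (k * (Cmod y ^ 2 / (1 - Cmod y)) <= k * (1 / (1 - rho))).
      { apply Rmult_le_compat_l; auto. apply Rmult_le_compat.
        - apply pow2_ge_0.
        - apply Rlt_le, Rinv_0_lt_compat; lra.
        - nra.
        - apply Rinv_le_contravar; lra. }
      lra. }
    assert (A2 : Cmod (dG y v) <= (1 + k / (1 - rho) ^ 2) * Cmod v).
    { assert (T : Cmod (dG y v) <= Cmod (dG y v - v)%C + Cmod v).
      { replace (dG y v) with ((dG y v - v) + v)%C at 1 by ring. apply Cmod_triangle. }
      assert (k * (1 / (1 - Cmod y) ^ 2 - 1) <= k * (1 / (1 - rho) ^ 2)).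
      { apply Rmult_le_compat_l; auto.
        assert (/ (1 - Cmod y) ^ 2 <= / (1 - rho) ^ 2).
        { apply Rinv_le_contravar; [apply pow_lt; lra|apply pow_incr; lra]. }
        lra. }
      assert (k * (1 / (1 - Cmod y) ^ 2 - 1) * Cmod v <= k * (1 / (1 - rho) ^ 2) * Cmod v)
        by now apply Rmult_le_compat_r.
      lra. }
    unfold dF. eapply Rle_trans; [apply Cmod_triangle|].
    rewrite !Cmod_mult, !Cmod_R, (Rabs_pos_eq (Cmod y ^ 2)) by apply pow2_ge_0.
    rewrite Rabs_mult, (Rabs_pos_eq 2) by lra.
    assert (A3 : Rabs (dot y v) <= 1 * Cmod v).
    { eapply Rle_trans; [apply dot_abs_le|]. apply Rmult_le_compat_r; lra. }
    assert (A4 : Rabs (dot y v) * Cmod (G y) <= (1 * Cmod v) * (1 + k / (1 - rho)))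
      by (apply Rmult_le_compat; auto using Rabs_pos, Cmod_ge_0).
    assert (A5 : Cmod y ^ 2 * Cmod (dG y v) <= 1 * ((1 + k / (1 - rho) ^ 2) * Cmod v)).
    { apply Rmult_le_compat; auto using Cmod_ge_0; [apply pow2_ge_0|nra]. }
    unfold L. lra. }
  intros z w Hz Hw. set (u := (F G z - F G w)%C).
  apply Cmod_le_dot.
  { apply Rmult_le_pos; [unfold L; lra|apply Cmod_ge_0]. }
  destruct (dot_mean_value (fun t => F G (w + RtoC t * (z - w))%C)
    (fun t => dF (w + RtoC t * (z - w))%C (z - w)%C) u 0 1) as [c [Hc E]]; [lra| |].
  - intros t Ht. apply F_directional. unfold disk.
    apply Rle_lt_trans with rho; [apply segment_norm; auto|lra].
  - replace (w + RtoC 1 * (z - w))%C with z in E by ring.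
    replace (w + RtoC 0 * (z - w))%C with w in E by ring.
    fold u in E. rewrite E. eapply Rle_trans.
    { rewrite Rminus_0_r, Rmult_1_r. apply dot_le. }
    rewrite Rmult_comm. apply Rmult_le_compat_r; [apply Cmod_ge_0|].
    apply D. apply segment_norm; auto; lra.
Qed.

(** The lower bound is [s] times the function of [s = |z|] whose value at [r3 M]
    defines [sigma3 M]. *)
Lemma F_radial (z : C) : disk 1 z ->
  Cmod z * (Cmod z ^ 3 - k * (Cmod z ^ 4 / (1 - Cmod z))) <= dot z (F G z).
Proof.
  intros Hz. pose proof (G_near z Hz) as E. unfold disk in Hz.
  replace (dot z (F G z)) with (Cmod z ^ 2 * (dot z z + dot z (G z - z)%C))
    by (unfold F, dot; simpl; unfold Re, Im; ring).
  rewrite dot_self. pose proof (Cmod_ge_0 z).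
  pose proof (dot_abs_le z (G z - z)%C) as A.
  pose proof (Rle_abs (- dot z (G z - z)%C)) as Q. rewrite Rabs_Ropp in Q.
  assert (Cmod z * Cmod (G z - z)%C <= Cmod z * (k * (Cmod z ^ 2 / (1 - Cmod z))))
    by now apply Rmult_le_compat_l.
  replace (Cmod z * (Cmod z ^ 3 - k * (Cmod z ^ 4 / (1 - Cmod z)))) with
    (Cmod z ^ 2 * (Cmod z ^ 2 - Cmod z * (k * (Cmod z ^ 2 / (1 - Cmod z)))))
    by (field; lra).
  apply Rmult_le_compat_l; [apply pow2_ge_0|lra].
Qed.

(** [F G - p] is monotone and, by [F_radial], points outwards near the circle of
    radius [rho], so that [monotone_zero] applies. *)
Lemma F_covers (r rho : R) (p : C) : r <= 1 -> 0 < rho < r ->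
  (forall s, 0 <= s < r ->
     k * (4 * (s / (1 - s)) + s ^ 2 / (1 - s) ^ 2) < 1) ->
  Cmod p < rho ^ 3 - k * (rho ^ 4 / (1 - rho)) ->
  exists z, disk r z /\ F G z = p.
Proof.
  intros Hr Hrho Hk Hp.
  destruct (F_lipschitz rho ltac:(lra)) as [L [HL HF]].
  set (psi := fun s => s * (s ^ 3 - k * (s ^ 4 / (1 - s)) - Cmod p)).
  assert (Cpsi : continuous psi rho).
  { apply (ex_derive_continuous (K := R_AbsRing) (V := R_NormedModule) psi).
    unfold psi. auto_derive. lra. }
  set (c := psi rho / 2).
  assert (Hc : 0 < c) by (unfold c, psi; apply Rdiv_lt_0_compat; [apply Rmult_lt_0_compat; lra|lra]).
  assert (E : locally rho (fun s : R => c < psi s)).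
  { apply (Cpsi (fun y => c < y)). apply (open_gt c). unfold c in *. lra. }
  (* Half the value at [rho] still bounds the radial component from below on an
     annulus inside the circle. *)
  destruct E as [[d dp] Hd]; simpl in Hd.
  destruct (monotone_zero rho L (d / 2) c (fun z => F G z - p)%C) as [z [Hz Ez]]; auto; try lra.
  - intros z w Hz Hw.
    replace (F G z - p - (F G w - p))%C with (F G z - F G w)%C by ring. auto.
  - intros z w Hz Hw.
    replace (F G z - p - (F G w - p))%C with (F G z - F G w)%C by ring.
    destruct (classic (w = z)) as [->|N].
    + replace (z - z)%C with (RtoC 0) by ring. unfold dot; simpl. lra.
    + apply Rlt_le, (F_strictly_monotone r); auto; unfold disk; lra.
  - intros z Hz. assert (Hz1 : disk 1 z) by (unfold disk; lra).
    pose proof (F_radial z Hz1) as R.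
    replace (dot z (F G z - p)%C) with (dot z (F G z) - dot z p)
      by (unfold dot; simpl; unfold Re, Im; ring).
    pose proof (dot_le z p).
    assert (P : c < psi (Cmod z)).
    { apply Hd. change (Rabs (Cmod z - rho) < d). apply Rabs_lt_between. lra. }
    unfold psi in P. lra.
  - exists z. split; [unfold disk; lra|].
    transitivity (F G z - p + p)%C; [ring|rewrite Ez; ring].
Qed.

End NearIdentity.

(** The bound on [s] is the root of [(1 - s)^2 = 4 k s (1 - s) + k s^2], as one
    sees by completing the square to
    [(1 - s - 2 k s)^2 = (k + 4 k^2) s^2]. *)
Lemma radius_condition (k s : R) : 0 <= k ->
  0 <= s < 1 / (1 + 2 * k + sqrt (k + 4 * k ^ 2)) ->
  s < 1 /\ k * (4 * (s / (1 - s)) + s ^ 2 / (1 - s) ^ 2) < 1.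
Proof.
  intros Hk [Hs0 Hs].
  assert (Q : 0 <= sqrt (k + 4 * k ^ 2)) by apply sqrt_pos.
  assert (Q2 : sqrt (k + 4 * k ^ 2) ^ 2 = k + 4 * k ^ 2)
    by (apply pow2_sqrt; nra).
  set (q := sqrt (k + 4 * k ^ 2)) in *.
  assert (H : s * (1 + 2 * k + q) < 1).
  { apply (Rmult_lt_compat_r (1 + 2 * k + q)) in Hs; [|lra].
    unfold Rdiv in Hs. rewrite Rmult_assoc, Rinv_l in Hs by lra. lra. }
  assert (s1 : s < 1) by nra. split; auto.
  assert (P : (q * s) ^ 2 < (1 - s - 2 * k * s) ^ 2).
  { assert (0 <= q * s) by nra. assert (q * s < 1 - s - 2 * k * s) by lra. nra. }
  assert (X : k * (4 * s * (1 - s) + s ^ 2) < (1 - s) ^ 2).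
  { rewrite Rpow_mult_distr, Q2 in P. nra. }
  replace (k * (4 * (s / (1 - s)) + s ^ 2 / (1 - s) ^ 2)) with
    (k * (4 * s * (1 - s) + s ^ 2) / (1 - s) ^ 2) by (field; lra).
  apply Rmult_lt_reg_r with ((1 - s) ^ 2); [apply pow_lt; lra|].
  unfold Rdiv. rewrite Rmult_assoc, Rinv_l by (apply pow_nonzero; lra). lra.
Qed.

(** * Normalisation by the differential at the origin *)

Lemma cderiv_conj (P : R -> C) (t : R) (l : C) :
  cderiv P t l -> cderiv (fun s => Cconj (P s)) t (Cconj l).
Proof.
  intros [h1 h2]; split; simpl; auto.
  now apply (is_derive_opp (V := R_NormedModule)).
Qed.

Definition lin (a b v : C) : C := (a * v + Cconj (b * v))%C.

Definition lin_inv (a b w : C) : C :=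
  (RtoC (/ (Cmod a ^ 2 - Cmod b ^ 2)) * (Cconj a * w - Cconj b * Cconj w))%C.

Lemma lin_inv_minus (a b v w : C) :
  lin_inv a b (v - w)%C = (lin_inv a b v - lin_inv a b w)%C.
Proof. unfold lin_inv. rewrite Cminus_conj. ring. Qed.

Lemma lin_inv_real (a b w : C) (x : R) :
  lin_inv a b (RtoC x * w)%C = (RtoC x * lin_inv a b w)%C.
Proof.
  unfold lin_inv. rewrite Cmult_conj.
  replace (Cconj (RtoC x)) with (RtoC x) by (apply C_ext; simpl; ring). ring.
Qed.

Lemma RtoC_neq0 (x : R) : x <> 0 -> RtoC x <> 0%C.
Proof. intros H E. injection E. auto. Qed.

Lemma lin_inv_lin (a b v : C) : Cmod a ^ 2 - Cmod b ^ 2 <> 0 ->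
  lin_inv a b (lin a b v) = v.
Proof.
  intros H. unfold lin_inv, lin. rewrite Cplus_conj, !Cmult_conj, !Cconj_conj.
  rewrite RtoC_inv, RtoC_minus by auto. rewrite !Cmod2_conj.
  field. rewrite <- !Cmod2_conj, <- RtoC_minus. now apply RtoC_neq0.
Qed.

Lemma lin_lin_inv (a b w : C) : Cmod a ^ 2 - Cmod b ^ 2 <> 0 ->
  lin a b (lin_inv a b w) = w.
Proof.
  intros H. unfold lin_inv, lin. set (d := / (Cmod a ^ 2 - Cmod b ^ 2)).
  rewrite !Cmult_conj, Cminus_conj, !Cmult_conj, !Cconj_conj.
  replace (Cconj (RtoC d)) with (RtoC d) by (apply C_ext; simpl; ring).
  transitivity (RtoC d * (a * Cconj a - b * Cconj b) * w)%C; [ring|].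
  rewrite <- !Cmod2_conj, <- RtoC_minus, <- RtoC_mult. unfold d.
  rewrite Rinv_l by auto. ring.
Qed.

Lemma cderiv_lin_inv (a b : C) (P : R -> C) (t : R) (l : C) :
  cderiv P t l -> cderiv (fun s => lin_inv a b (P s)) t (lin_inv a b l).
Proof.
  intros H. unfold lin_inv. set (d := RtoC (/ _)).
  apply cderiv_ext with
    (fun s => (d * (Cconj a * P s + (- Cconj b) * Cconj (P s)))%C); [intro; ring|].
  eapply cderiv_eq;
    [|exact (cderiv_mult _ _ _ _ _ (cderiv_const d t)
      (cderiv_plus _ _ _ _ _
         (cderiv_mult _ _ _ _ _ (cderiv_const (Cconj a) t) H)
         (cderiv_mult _ _ _ _ _ (cderiv_const (- Cconj b)%C t) (cderiv_conj _ _ _ H))))].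
  cbv beta. ring.
Qed.

(** The norm of the inverse is
    [(|a| + |b|) / ||a|^2 - |b|^2| = 1 / ||a| - |b||]. *)
Lemma Cmod_lin_inv (a b w : C) : Rabs (Cmod a - Cmod b) = 1 ->
  Cmod (lin_inv a b w) <= Cmod w.
Proof.
  intros H. unfold lin_inv. pose proof (Cmod_ge_0 a). pose proof (Cmod_ge_0 b).
  assert (S : 0 < Cmod a + Cmod b).
  { destruct (Req_dec (Cmod a + Cmod b) 0); [|lra].
    replace (Cmod a) with 0 in H by lra. replace (Cmod b) with 0 in H by lra.
    rewrite Rminus_0_r, Rabs_R0 in H. lra. }
  rewrite Cmod_mult, Cmod_R, Rabs_inv.
  replace (Cmod a ^ 2 - Cmod b ^ 2) with ((Cmod a - Cmod b) * (Cmod a + Cmod b)) by ring.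
  rewrite Rabs_mult, H, Rmult_1_l, Rabs_pos_eq by lra.
  apply Rmult_le_reg_l with (Cmod a + Cmod b); auto.
  rewrite <- Rmult_assoc, Rinv_r, Rmult_1_l by lra.
  eapply Rle_trans; [apply Cmod_triangle|].
  rewrite Cmod_opp, !Cmod_mult, !Cmod_conj. lra.
Qed.

Lemma pair_directional (g f e : C -> C) : harmonic_pair (disk 1) g f e ->
  directional g (fun z v => lin (f z) (e z) v).
Proof.
  intros [H _] z v t Hz. apply wirtinger_chain; [now apply H|].
  apply cderiv_segment.
Qed.

(** [k x^2 / (1 - x)] is the primitive of [k (1 / (1 - x)^2 - 1)] vanishing at 0.
    The bound on the derivatives is integrated along the radius by the mean value
    theorem, after projection on the vector [u] to be estimated. *)
Lemma value_deviation (k : R) (g f e : C -> C) (z : C) :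
  harmonic_pair (disk 1) g f e -> g 0%C = 0%C -> disk 1 z ->
  (forall w, disk 1 w ->
     Cmod (f w - f 0)%C + Cmod (e w - e 0)%C <= k * (1 / (1 - Cmod w) ^ 2 - 1)) ->
  Cmod (g z - lin (f 0) (e 0) z)%C <= k * (Cmod z ^ 2 / (1 - Cmod z)).
Proof.
  intros Hp g0 Hz Hd. set (u := (g z - lin (f 0) (e 0) z)%C).
  set (s := Cmod z). assert (Hs : 0 <= s < 1) by (split; [apply Cmod_ge_0|exact Hz]).
  assert (Ht : forall t, 0 <= t <= 1 -> Cmod (0 + RtoC t * z)%C = t * s).
  { intros t Ht. rewrite Cplus_0_l, Cmod_mult, Cmod_R, Rabs_pos_eq by lra. auto. }
  set (P := fun t => (g (0 + RtoC t * z) + RtoC t * - lin (f 0) (e 0) z)%C).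
  set (phi := fun t => dot u (P t) - Cmod u * (k * ((t * s) ^ 2 / (1 - t * s)))).
  assert (D : forall t, 0 <= t <= 1 -> derivable_pt_lim phi t
     (dot u (lin (f (0 + RtoC t * z)%C) (e (0 + RtoC t * z)%C) z - lin (f 0) (e 0) z)%C -
      Cmod u * (k * (s * (1 / (1 - t * s) ^ 2 - 1))))).
  { intros t Htt. assert (ts : t * s < 1) by nra.
    assert (C1 : cderiv P t
      (lin (f (0 + RtoC t * z)%C) (e (0 + RtoC t * z)%C) z - lin (f 0) (e 0) z)%C).
    { eapply cderiv_eq; [|exact (cderiv_plus _ _ _ _ _
        (pair_directional g f e Hp 0%C z t ltac:(unfold disk; rewrite Ht; lra))
        (cderiv_mult _ _ _ _ _
          (cderiv_RtoC _ _ _ (is_derive_id (K := R_AbsRing) t))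
          (cderiv_const (- lin (f 0) (e 0) z)%C t)))].
      cbv beta. change (RtoC (@one R_AbsRing)) with (RtoC 1). ring. }
    destruct C1 as [h1 h2]. apply is_derive_Reals in h1, h2.
    apply (derivable_pt_lim_minus (fun t => dot u (P t))
      (fun t => Cmod u * (k * ((t * s) ^ 2 / (1 - t * s))))).
    - exact (derivable_pt_lim_plus _ _ _ _ _
        (derivable_pt_lim_scal _ (Re u) _ _ h1) (derivable_pt_lim_scal _ (Im u) _ _ h2)).
    - apply is_derive_Reals. auto_derive; [lra|]. field. lra. }
  destruct (MVT_cor2 phi _ 0 1 ltac:(lra) D) as [c [E Hc]].
  set (y := (0 + RtoC c * z)%C) in *.
  assert (Hy : Cmod y = c * s) by (apply Ht; lra).
  assert (Hle : dot u (lin (f y) (e y) z - lin (f 0) (e 0) z)%C <=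
     Cmod u * (k * (s * (1 / (1 - c * s) ^ 2 - 1)))).
  { eapply Rle_trans; [apply dot_le|]. apply Rmult_le_compat_l; [apply Cmod_ge_0|].
    replace (lin (f y) (e y) z - lin (f 0) (e 0) z)%C with
      ((f y - f 0) * z + Cconj ((e y - e 0) * z))%C.
    2:{ unfold lin. rewrite !Cmult_conj, Cminus_conj. ring. }
    eapply Rle_trans; [apply Cmod_triangle|].
    rewrite Cmod_conj, !Cmod_mult. fold s. rewrite <- Hy.
    assert (Hy1 : disk 1 y) by (unfold disk; rewrite Hy; nra).
    specialize (Hd y Hy1). nra. }
  assert (E1 : phi 1 = Cmod u ^ 2 - Cmod u * (k * (s ^ 2 / (1 - s)))).
  { unfold phi, P. replace (0 + RtoC 1 * z)%C with z by ring.
    replace (g z + RtoC 1 * - lin (f 0) (e 0) z)%C with u by (unfold u; ring).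
    rewrite dot_self, Rmult_1_l. ring. }
  assert (E0 : phi 0 = 0).
  { unfold phi, P. replace (0 + RtoC 0 * z)%C with (RtoC 0) by ring. rewrite g0.
    replace (0 + RtoC 0 * - lin (f 0) (e 0) z)%C with (RtoC 0) by ring.
    unfold dot; simpl. field. }
  rewrite E1, E0 in E.
  assert (B : Cmod u * Cmod u <= (k * (s ^ 2 / (1 - s))) * Cmod u) by nra.
  destruct (Req_dec (Cmod u) 0) as [U|U].
  - rewrite U. apply Rmult_le_pos.
    + assert (Hw : disk 1 (RtoC (1/2))) by (unfold disk; rewrite Cmod_R, Rabs_pos_eq; lra).
      specialize (Hd _ Hw). rewrite Cmod_R, Rabs_pos_eq in Hd by lra.
      pose proof (Cmod_ge_0 (f (RtoC (1/2)) - f 0)%C).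
      pose proof (Cmod_ge_0 (e (RtoC (1/2)) - e 0)%C). lra.
    + apply Rdiv_le_0_compat; [apply pow2_ge_0|lra].
  - pose proof (Cmod_ge_0 u). apply Rmult_le_reg_r with (Cmod u); lra.
Qed.

(** * The radii *)

Lemma K_nonneg (M : R) : 0 <= M -> 0 <= K M.
Proof.
  intros HM. unfold K. apply Rmin_glb; [apply sqrt_pos|].
  apply Rdiv_le_0_compat; [lra|apply PI_RGT_0].
Qed.

Lemma K_zero (M : R) : 0 <= M <= 1 -> K M = 0.
Proof.
  intros HM. unfold K. rewrite sqrt_neg_0 by nra. apply Rmin_left.
  apply Rdiv_le_0_compat; [lra|apply PI_RGT_0].
Qed.

Lemma r3_of_K_zero (M : R) : K M = 0 -> r3 M = 1.
Proof.
  intros H. unfold r3. rewrite H.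
  replace (0 + 4 * 0 ^ 2) with 0 by ring. rewrite sqrt_0. field.
Qed.

Lemma r3_range (M : R) : 0 <= M -> 0 < r3 M <= 1.
Proof.
  intros HM. pose proof (K_nonneg M HM).
  pose proof (sqrt_pos (K M + 4 * K M ^ 2)). unfold r3. split.
  - apply Rdiv_lt_0_compat; lra.
  - unfold Rdiv. rewrite Rmult_1_l, <- Rinv_1. apply Rinv_le_contravar; lra.
Qed.

Lemma r3_lt_1 (M : R) : 1 < M -> r3 M < 1.
Proof.
  intros HM. assert (HK : 0 < K M).
  { unfold K. apply Rmin_glb_lt; [apply sqrt_lt_R0; nra|].
    apply Rdiv_lt_0_compat; [lra|apply PI_RGT_0]. }
  pose proof (sqrt_pos (K M + 4 * K M ^ 2)). unfold r3.
  unfold Rdiv. rewrite Rmult_1_l. rewrite <- Rinv_1 at 2. apply Rinv_lt_contravar; lra.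
Qed.

(** [sigma3 M] is the left limit at [r3 M] of the function on the right. This
    covers the second case of its definition, where [K M = 0] and [r3 M = 1]. *)
Lemma sigma3_approx (M x : R) : 0 <= M -> x < sigma3 M ->
  exists rho, 0 < rho < r3 M /\ x < rho ^ 3 - K M * (rho ^ 4 / (1 - rho)).
Proof.
  intros HM Hx. apply NNPP. intro Hno.
  pose proof (r3_range M HM) as Hr.
  assert (H : forall rho, 0 < rho < r3 M ->
     - x <= - (rho ^ 3 - K M * (rho ^ 4 / (1 - rho)))).
  { intros rho Hrho. apply Rnot_lt_le. intro L. apply Hno. exists rho. split; auto. lra. }
  unfold sigma3 in Hx. destruct Rlt_dec as [h|h].
  - pose proof (r3_lt_1 M h).
    enough (- x <= - (r3 M ^ 3 - K M * (r3 M ^ 4 / (1 - r3 M)))) by lra.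
    apply (le_of_left_limit (- x) 0 (r3 M)
      (fun rho => - (rho ^ 3 - K M * (rho ^ 4 / (1 - rho))))); auto; [lra|].
    apply (ex_derive_continuous (K := R_AbsRing) (V := R_NormedModule)
      (fun rho => - (rho ^ 3 - K M * (rho ^ 4 / (1 - rho))))).
    auto_derive. lra.
  - assert (K0 : K M = 0) by (apply K_zero; lra).
    rewrite (r3_of_K_zero M K0) in *.
    enough (- x <= - 1 ^ 3) by lra.
    apply (le_of_left_limit (- x) 0 1 (fun rho => - rho ^ 3)); [lra| |].
    + apply (ex_derive_continuous (K := R_AbsRing) (V := R_NormedModule)
        (fun rho => - rho ^ 3)). auto_derive; auto.
    + intros rho Hrho. specialize (H rho Hrho). rewrite K0 in H. lra.
Qed.

(** [lin a b] is the differential of [g] at 0, and its inverse [J] commutes with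
    the real factor [|z|^2]. So [J o F g = F (J o g)], where [J o g] is close to
    the identity. [J] is bijective and does not increase norms, hence both
    properties pass from [F (J o g)] to [F g]. *)
Lemma univalence_and_covering (M : R) (g : C -> C) : admissible M g ->
  univalent_in (disk 1) (F g) (disk (r3 M)) /\
  image_contains (F g) (disk (r3 M)) (disk (sigma3 M)).
Proof.
  intros [Hharm [g0 [Hlam HM]]].
  assert (M0 : 0 <= M).
  { eapply Rle_trans; [apply Cmod_ge_0|]. apply (HM 0%C).
    unfold disk. rewrite Cmod_0. lra. }
  pose proof (harmonic_pair_of_harmonic 1 g Hharm) as Hp.
  set (f := Dz g) in *. set (e := fun z => Cconj (Dzbar g z)) in *.
  assert (Hst : Rabs (Cmod (f 0%C) - Cmod (e 0%C)) = 1).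
  { unfold lambda in Hlam. unfold e. rewrite Cmod_conj. unfold f. lra. }
  set (a := f 0%C) in *. set (b := e 0%C) in *.
  pose proof (Cmod_ge_0 a) as A0. pose proof (Cmod_ge_0 b) as B0.
  assert (Hsq : (Cmod a - Cmod b) ^ 2 = 1).
  { rewrite <- Rsqr_pow2, Rsqr_abs, Hst. unfold Rsqr; ring. }
  assert (H1 : 1 <= Cmod a ^ 2 + Cmod b ^ 2) by nra.
  assert (Hdet : Cmod a ^ 2 - Cmod b ^ 2 <> 0).
  { intro E. assert (E' : (Cmod a - Cmod b) * (Cmod a + Cmod b) = 0) by lra.
    apply Rmult_integral in E'. destruct E' as [E'|E']; nra. }
  pose proof (gradient_deviation M g f e Hp HM H1) as Hdev.
  pose proof (K_nonneg M M0) as K0.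
  set (J := lin_inv a b).
  set (G := fun z => J (g z)).
  set (dG := fun z v => J (lin (f z) (e z) v)).
  assert (Gdir : directional G dG).
  { intros z v t Hz. apply cderiv_lin_inv. now apply (pair_directional g f e Hp). }
  assert (Gnear : forall z, disk 1 z ->
     Cmod (G z - z)%C <= K M * (Cmod z ^ 2 / (1 - Cmod z))).
  { intros z Hz.
    replace (G z - z)%C with (J (g z - lin a b z)%C)
      by (unfold G, J; now rewrite lin_inv_minus, lin_inv_lin).
    eapply Rle_trans; [apply Cmod_lin_inv, Hst|].
    apply value_deviation; auto. }
  assert (dGnear : forall z v, disk 1 z ->
     Cmod (dG z v - v)%C <= K M * (1 / (1 - Cmod z) ^ 2 - 1) * Cmod v).
  { intros z v Hz.
    replace (dG z v - v)%C with (J (lin (f z) (e z) v - lin a b v)%C)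
      by (unfold dG, J; now rewrite lin_inv_minus, lin_inv_lin).
    eapply Rle_trans; [apply Cmod_lin_inv, Hst|].
    replace (lin (f z) (e z) v - lin a b v)%C with
      ((f z - a) * v + Cconj ((e z - b) * v))%C.
    2:{ unfold lin. rewrite !Cmult_conj, Cminus_conj. ring. }
    eapply Rle_trans; [apply Cmod_triangle|].
    rewrite Cmod_conj, !Cmod_mult, <- Rmult_plus_distr_r.
    apply Rmult_le_compat_r; [apply Cmod_ge_0|]. now apply Hdev. }
  assert (JF : forall z, J (F g z) = F G z).
  { intros z. unfold F, J. now rewrite lin_inv_real. }
  pose proof (r3_range M M0) as Hr.
  assert (Hrad : forall s, 0 <= s < r3 M ->
     K M * (4 * (s / (1 - s)) + s ^ 2 / (1 - s) ^ 2) < 1)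
    by (intros s Hs; now apply radius_condition).
  split.
  - split.
    + unfold disk. intros z Hz. lra.
    + intros z1 z2 Hz1 Hz2 E. apply NNPP. intro N.
      pose proof (F_strictly_monotone (K M) G dG Gdir Gnear dGnear (r3 M) z1 z2
        (proj2 Hr) Hrad Hz1 Hz2 N) as P.
      rewrite <- !JF, E in P.
      replace (J (F g z2) - J (F g z2))%C with (RtoC 0) in P by ring.
      unfold dot in P; simpl in P. lra.
  - intros w Hw. unfold disk in Hw.
    destruct (sigma3_approx M (Cmod w) M0 Hw) as [rho [Hrho Hs]].
    destruct (F_covers (K M) G dG K0 Gdir Gnear dGnear (r3 M) rho (J w)
      (proj2 Hr) Hrho Hrad) as [z [Hz Ez]].
    { eapply Rle_lt_trans; [apply Cmod_lin_inv, Hst|exact Hs]. }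
    exists z. split; auto. rewrite <- JF in Ez.
    rewrite <- (lin_lin_inv a b w Hdet), <- (lin_lin_inv a b (F g z) Hdet).
    now f_equal.
Qed.

(** * The identity map and sharpness *)

Lemma id_admissible : admissible 1 (fun z => z).
Proof.
  assert (X1 : forall y x : R, is_derive (fun t => Re (t, y)) x 1)
    by (intros; simpl; auto_derive; auto).
  assert (X2 : forall y x : R, Derive (fun t => Re (t, y)) x = 1)
    by (intros; apply is_derive_unique, X1).
  assert (Y2 : forall y x : R, Derive (fun t => Im (x, t)) y = 1)
    by (intros; apply is_derive_unique; simpl; auto_derive; auto).
  assert (X3 : forall y x : R, Derive (fun t => Re (x, t)) y = 0)
    by (intros; exact (Derive_const x y)).
  assert (Y3 : forall y x : R, Derive (fun t => Im (t, y)) x = 0)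
    by (intros; exact (Derive_const y x)).
  assert (C2 : forall (c : R) x y, ex_diff_n (fun _ _ => c) 1 x y).
  { intros c x y. simpl. repeat split;
      try apply ex_derive_const; try apply continuity_2d_pt_const;
      apply continuity_2d_pt_ext with (fun _ _ => 0);
      try (intros; now rewrite Derive_const); apply continuity_2d_pt_const. }
  split; [split|split; [|split]].
  - change (harmonic_real_on (disk 1) (fun x y => x)). intros x y _. split.
    + split; [apply continuity_2d_pt_id1|split; [apply (ex_derive_id (K := R_AbsRing))|
        split; [apply ex_derive_const|split]]].
      * apply ex_diff_n_ext_loc with (fun _ _ => 1); auto.
        apply locally_2d_forall. intros u v; symmetry; apply (X2 v u).
      * apply ex_diff_n_ext_loc with (fun _ _ => 0); auto.
        apply locally_2d_forall. intros u v; symmetry; apply (X3 v u).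
    + unfold partial_derive; simpl.
      rewrite (Derive_ext _ (fun _ => 1)) by (intro; apply (X2 0)).
      rewrite (Derive_ext (fun z => Derive _ z) (fun _ => 0)) by (intro; apply Derive_const).
      rewrite !Derive_const. ring.
  - change (harmonic_real_on (disk 1) (fun x y => y)). intros x y _. split.
    + split; [apply continuity_2d_pt_id2|split; [apply ex_derive_const|
        split; [apply (ex_derive_id (K := R_AbsRing))|split]]].
      * apply ex_diff_n_ext_loc with (fun _ _ => 0); auto.
        apply locally_2d_forall. intros u v; symmetry; apply (Y3 v u).
      * apply ex_diff_n_ext_loc with (fun _ _ => 1); auto.
        apply locally_2d_forall. intros u v; symmetry; apply (Y2 v u).
    + unfold partial_derive; simpl.
      rewrite (Derive_ext _ (fun _ => 0)) by (intro; apply Derive_const).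
      rewrite (Derive_ext (fun z => Derive _ z) (fun _ => 1)) by (intro; apply Derive_id).
      rewrite !Derive_const. ring.
  - reflexivity.
  - unfold lambda, Dz, Dzbar, Dx, Dy. rewrite !X2, !X3, !Y2, !Y3.
    replace (RtoC (1 / 2) * ((1, 0) - Ci * (0, 1)))%C with (RtoC 1)
      by (apply C_ext; simpl; field).
    replace (RtoC (1 / 2) * ((1, 0) + Ci * (0, 1)))%C with (RtoC 0)
      by (apply C_ext; simpl; field).
    rewrite !Cmod_R, Rabs_R0, Rabs_R1, Rminus_0_r, Rabs_R1. ring.
  - intros z Hz. unfold disk in Hz. lra.
Qed.

Theorem theorem2p10 :
  (forall (M : R) (g : C -> C), admissible M g ->
     univalent_in (disk 1) (F g) (disk (r3 M)) /\
     image_contains (F g) (disk (r3 M)) (disk (sigma3 M))) /\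
  (r3 1 = 1 /\ sigma3 1 = 1 /\
   (forall r : R, r3 1 < r ->
      ~ (forall g : C -> C, admissible 1 g ->
           univalent_in (disk 1) (F g) (disk r))) /\
   (forall s : R, sigma3 1 < s ->
      ~ (forall g : C -> C, admissible 1 g ->
           image_contains (F g) (disk (r3 1)) (disk s)))).
Proof.
  assert (R1 : r3 1 = 1) by (apply r3_of_K_zero, K_zero; lra).
  assert (S1 : sigma3 1 = 1) by (unfold sigma3; destruct Rlt_dec; [lra|auto]).
  split; [exact univalence_and_covering|].
  rewrite R1, S1. do 2 (split; [reflexivity|]). split.
  - (* Univalence in a disk includes that the disk lies in the domain. *)
    intros r Hr H. destruct (H _ id_admissible) as [Hsub _].
    assert (D : disk 1 (RtoC 1)) by (apply Hsub; unfold disk; rewrite Cmod_1; lra).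
    unfold disk in D. rewrite Cmod_1 in D. lra.
  - (* For the identity [|F z| = |z|^3 < 1], so 1 is not a value. *)
    intros s Hs H.
    destruct (H _ id_admissible (RtoC 1)) as [z [Hz E]].
    { unfold disk; rewrite Cmod_1; lra. }
    unfold disk in Hz. apply (f_equal Cmod) in E. unfold F in E.
    rewrite Cmod_mult, Cmod_R, Cmod_1, Rabs_pos_eq in E by apply pow2_ge_0.
    pose proof (Cmod_ge_0 z). nra.
Qed.
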